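(* Consider an $M^{X}/G/1$ queue operating under the LCFS-p-resume discipline, with Poisson batch arrivals of rate $\lambda$, i.i.d. batch sizes distributed as $X$ with mean $\mu$, i.i.d. service times distributed as $S$ (all independent), and $\lambda\mu ES<1$. Let $X_0$ be the number of customers in the first batch of a busy period, let customer 0 be the first customer to enter service in the busy period, with service time $S_0$, and let $N=N(S_0)$ be the number of Poisson batch-arrival epochs that occur while customer 0 is actually being served (i.e., during a total of $S_0$ units of service given to customer 0). Let $M$ be the maximum number of customers in the system during a busy period, and let $M(k,n)$ and $M(k)$ denote random variables distributed as $M$ conditionally on $\{X_0=k,N=n\}$ and on $\{X_0=k\}$, respectively. Let $M_1,M_2,\ldots$ be i.i.d. copies of $M$, with $\max_{i=1,\ldots,n}M_i:=0$ when $n=0$. Then for all $k\geq 1$ and $n\geq 0$, $$M(k,n)=_d\max\Big\{\max_{i=1,\ldots,n}M_i+k;\;M(k-1)\Big\},$$ where $M(0)=0$ and $M_1,M_2,\ldots$ and $M(k-1)$ are independent.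
   Context: Under LCFS-p-resume, the customer who has been in the system the least amount of time is always served, newly arriving customers preempt the customer in service, customers within a batch are labeled arbitrarily (treated as arriving sequentially, immediately after each other), service is non-idling, and preempted customers resume service where they left off (so a service time $S$ preempted after $t$ units of service has remaining service time distributed as $[S-t\mid S>t]$). The notation $Y=_d Z$ means equality in distribution. *)

(* Defs.v *)
From HB Require Import structures.
From mathcomp Require Import all_boot all_order all_algebra.
From mathcomp Require Import all_classical all_reals all_analysis measurable_realfun.
Set Implicit Arguments. Unset Strict Implicit. Unset Printing Implicit Defensive.
Import Order.TTheory GRing.Theory Num.Theory.
Import numFieldNormedType.Exports.
Local Open Scope classical_set_scope.
Local Open Scope ring_scope.

(* Deterministic sample-path dynamics of one busy period of the M^X/G/1     *)
(* queue under LCFS-p-resume, driven by                                     *)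
(*   A j  : interarrival time between batch j-1 and batch j (j >= 1),       *)
(*          batch 0 (the first batch of the busy period) arrives at time 0, *)
(*   B j  : size of batch j (j >= 1); the size of batch 0 is a parameter k, *)
(*   S c  : service time of the c-th customer to arrive (c = 0, 1, ...),    *)
(*          customers inside a batch being labelled consecutively, i.e.     *)
(*          treated as arriving sequentially, immediately after each other. *)
(* The state is recorded at event epochs (arrivals / departures).  The      *)
(* stack lists (customer id, remaining service time), head = in service.    *)

Record qstate (R : realType) := QState {
  q_time : R;
  q_stack : seq (nat * R);
  q_next_batch : nat;
  q_next_id : nat }.

Section Queue.
Variable R : realType.
Variables (A : nat -> R) (B : nat -> nat) (S : nat -> R).

Definition arrival_time (j : nat) : R := \sum_(1 <= i < j.+1) A i.

(* the newly arrived customers of a batch, last arrival on top (it preempts) *)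
Definition new_customers (c b : nat) : seq (nat * R) :=
  rev [seq (c + i, S (c + i))%N | i <- iota 0 b].

(* one event of the LCFS-p-resume dynamics; an empty system is absorbing
   (end of the busy period) *)
Definition step (st : qstate R) : qstate R :=
  match q_stack st with
  | [::] => st
  | (id, r) :: rest =>
    let t := q_time st in
    let ta := arrival_time (q_next_batch st) in
    if t + r <= ta then
      QState (t + r) rest (q_next_batch st) (q_next_id st)
    else
      QState ta
        (new_customers (q_next_id st) (B (q_next_batch st))
           ++ (id, r - (ta - t)) :: rest)
        (q_next_batch st).+1 (q_next_id st + B (q_next_batch st))%N
  end.

Definition init_state (k : nat) : qstate R :=
  QState 0 (new_customers 0 k) 1 k.

Definition traj (k n : nat) : qstate R := iter n step (init_state k).

(* maximum number of customers in the system during the busy period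
   started by a batch of size k (the number in system only changes at
   event epochs) *)
Definition busy_max (k : nat) : \bar R :=
  ereal_sup (range (fun n => ((size (q_stack (traj k n)))%:R)%:E)).

(* customer 0 = first customer to enter service = last customer of batch 0 *)
Definition cust0 (k : nat) : nat := k.-1.

Definition arrival_during (id : nat) (st : qstate R) : bool :=
  match q_stack st with
  | [::] => false
  | (id', r) :: _ =>
      (id' == id) && ~~ (q_time st + r <= arrival_time (q_next_batch st))
  end.

Definition arrivals_during_cust0 (k m : nat) : nat :=
  count (fun i => arrival_during (cust0 k) (traj k i)) (iota 0 m).

Definition serv0_arrivals (k : nat) : \bar R :=
  ereal_sup (range (fun m => ((arrivals_during_cust0 k m)%:R)%:E)).

End Queue.

(* mutual independence of all A i, B i, S i (product rule for every finite
   subfamily; sets equal to setT give the subfamilies) *)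
Definition inputs_independent (R : realType) (d : measure_display)
  (T : measurableType d) (P : probability T R)
  (A : nat -> T -> R) (B : nat -> T -> nat) (S : nat -> T -> R) : Prop :=
  forall (n : nat) (a s : nat -> set R) (b : nat -> set nat),
    (forall i, measurable (a i)) -> (forall i, measurable (s i)) ->
    P (\bigcap_(i in `I_n) (A i @^-1` a i `&` B i @^-1` b i `&` S i @^-1` s i))
    = (\prod_(i < n) (fine (P (A i @^-1` a i)) * fine (P (B i @^-1` b i))
                       * fine (P (S i @^-1` s i))))%:E.

Definition family_independent (R : realType) (d : measure_display)
  (T : measurableType d) (Q : probability T R) (n : nat)
  (Y : 'I_n -> T -> \bar R) (Z : T -> \bar R) : Prop :=
  forall (b : 'I_n -> set (\bar R)) (c : set (\bar R)),
    (forall i, measurable (b i : set (\bar R))) -> measurable (c : set (\bar R)) ->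
    Q (Z @^-1` c `&` \bigcap_(i in [set: 'I_n]) (Y i @^-1` b i))
    = (fine (Q (Z @^-1` c)) * \prod_(i < n) fine (Q (Y i @^-1` b i)))%:E.

Definition cond_prob (R : realType) (d : measure_display)
  (T : measurableType d) (P : probability T R) (Y : T -> \bar R)
  (E : set T) (V : set (\bar R)) : R :=
  fine (P (Y @^-1` V `&` E)) / fine (P E).

(* Main.v *)
(** Each batch that preempts the customer in service starts a sub-busy period on
    top of the current stack, and the preempted customer resumes when the stack is
    back at its previous height.  By memorylessness of the gaps and independence of
    the inputs not yet used, what follows such a return is driven by a fresh copy
    of the input.  Given [n] arrivals during the service of customer 0, the
    sub-busy periods are therefore [n] independent busy periods lifted by [k]
    customers, and after the departure of customer 0 a busy period started by
    [k - 1] customers remains.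

    The busy period is described by a recursion truncated at a depth [m], for which
    this factorization is an exact identity between probabilities.  Stability serves
    to let [m] tend to infinity: the limiting probability [delta] that a busy period
    is not completed satisfies [delta <= lam * E[X] * E[S] * delta]. *)
Require Import Defs.
From HB Require Import structures.
From mathcomp Require Import all_boot all_order all_algebra.
From mathcomp Require Import all_classical all_reals all_analysis measurable_realfun.
From mathcomp Require Import zify ring lra.
Import Order.TTheory GRing.Theory Num.Theory.
Import numFieldNormedType.Exports.
Local Open Scope classical_set_scope.
Local Open Scope ring_scope.

(** * Busy periods as a recursion *)

Section BigStep.
Context {R : realType}.

(** The obstacle is that the input left at the end of a sub-busy period begins at a random place in
    each of the three sequences, and the number of these periods is itself random. Independence at
    such times is therefore stated as an integral identity ([regenerative]), which passes through
    the recursion one random input at a time. Conditioning on [N = n] works because the probability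
    that a service of length [r] sees exactly [n] arrivals with peak at most [x] is a factor in [x]
    times a factor in [r]. The latter, averaged over the service time, also appears in the
    probability of [N = n] and cancels. Levels [x] are extended reals, so the conditioning event is
    the case [x = +oo]. Truncation spoils identical distribution, since successive sub-busy periods
    get less and less fuel; a true power appears only in the limit. The bound on [delta] combines
    two union bounds: a batch fails with probability at most [E[X]] times that of one service, and a
    service of length [r] with probability at most [delta] times [lam * r], the mean number of
    arrivals. *)

Definition scons {T : Type} (x : T) (u : nat -> T) : nat -> T :=
  fun n => if n is n'.+1 then u n' else x.

Definition stail {T : Type} (u : nat -> T) : nat -> T := fun n => u n.+1.

(* The inputs not yet used: the residual gap before the next arrival followed by
   the later gaps, the sizes of the coming batches, the coming service times. *)
Definition input : Type := ((nat -> R) * (nat -> nat) * (nat -> R))%type.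

(* [(completed, (peak, arrivals), input left)]: the peak counts the customers above
   the stack that was present before, the arrivals are those during the own service
   of the first customer served. *)
Definition outcome : Type := (bool * (nat * nat) * input)%type.

Definition gap (xi : input) : R := xi.1.1 0%N.
Definition bsize (xi : input) : nat := xi.1.2 0%N.
Definition svc (xi : input) : R := xi.2 0%N.

Definition consA (a : R) (xi : input) : input := (scons a xi.1.1, xi.1.2, xi.2).
Definition consB (b : nat) (xi : input) : input := (xi.1.1, scons b xi.1.2, xi.2).
Definition consS (s : R) (xi : input) : input := (xi.1, scons s xi.2).
Definition tailA (xi : input) : input := (stail xi.1.1, xi.1.2, xi.2).
Definition tailB (xi : input) : input := (xi.1.1, stail xi.1.2, xi.2).
Definition tailS (xi : input) : input := (xi.1, stail xi.2).

Definition elapse (r : R) (xi : input) : input := consA (gap xi - r) (tailA xi).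

Definition ok (rho : outcome) : bool := rho.1.1.
Definition height (rho : outcome) : nat := rho.1.2.1.
Definition arrivals (rho : outcome) : nat := rho.1.2.2.

(* The customer owning the first service time of the input lies at the bottom of its
   batch and is served last. *)
Fixpoint batch (sv : R -> input -> outcome) (b : nat) (xi : input) : outcome :=
  if b is b'.+1 then
    let rho1 := batch sv b' (tailS xi) in
    let rho2 := sv (svc xi) rho1.2 in
    (ok rho1 && ok rho2,
     (maxn (height rho1).+1 (height rho2),
      if (b' == 0)%N then arrivals rho2 else arrivals rho1),
     rho2.2)
  else (true, (0%N, 0%N), xi).

(* The fuel [m] bounds the nesting depth of preemptions plus the number of own
   arrivals; without fuel the outcome is not [ok]. *)
Fixpoint serve (m : nat) (r : R) (xi : input) : outcome :=
  if m is m'.+1 then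
    if r <= gap xi then (true, (1%N, 0%N), elapse r xi)
    else
      let rho1 := batch (serve m') (bsize xi) (tailB (tailA xi)) in
      let rho2 := serve m' (r - gap xi) rho1.2 in
      (ok rho1 && ok rho2,
       (maxn (height rho1).+1 (height rho2), (arrivals rho2).+1),
       rho2.2)
  else (false, (0%N, 0%N), xi).

(** * Agreement of the recursion with the event-by-event dynamics *)

Section Link.
Variables (A : nat -> R) (B : nat -> nat) (S : nat -> R).
Local Notation step := (step A B S).

(** The head gap is the time still to run from the current clock, so that a state reached in the
    middle of a gap is again described by an [input]. *)
Definition residual (st : qstate R) : input :=
  (scons (arrival_time A (q_next_batch st) - q_time st)
     (fun i => A (q_next_batch st + i.+1)%N),
   (fun i => B (q_next_batch st + i)%N),
   (fun i => S (q_next_id st + i)%N)).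

Definition peak (st : qstate R) (n : nat) : nat :=
  \max_(i < n.+1) size (q_stack (iter i step st)).

Definition arrival_count (id : nat) (st : qstate R) (n : nat) : nat :=
  count (fun i => arrival_during A id (iter i step st)) (iota 0 n).

Lemma peak0 st : peak st 0 = size (q_stack st).
Proof. by rewrite /peak big_ord_recl big_ord0 maxn0. Qed.

Lemma peakS st n : peak st n.+1 = maxn (size (q_stack st)) (peak (step st) n).
Proof.
rewrite /peak big_ord_recl; congr maxn; apply: eq_bigr => i _.
by rewrite lift0 iterSr.
Qed.

Lemma peakD st n m : peak st (n + m) = maxn (peak st n) (peak (iter n step st) m).
Proof.
elim: n st => [|n IH] st; first by
    rewrite add0n peak0 /= /peak big_ord_recl /= maxnA maxnn.
by rewrite addSn !peakS IH maxnA iterSr.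
Qed.

Lemma arrival_countS id st n : arrival_count id st n.+1 = (arrival_during A id st + arrival_count id (step st) n)%N.
Proof.
rewrite /arrival_count -[n.+1]/(1 + n)%N iotaD count_cat /= addn0; congr addn.
rewrite (iotaDl 1 0) count_map; apply: eq_count => i.
by rewrite -iterSr.
Qed.

Lemma arrival_countD id st n m : arrival_count id st (n + m) = (arrival_count id st n + arrival_count id (iter n step st) m)%N.
Proof.
elim: n st => [|n IH] st //.
by rewrite addSn !arrival_countS IH addnA iterSr.
Qed.

Lemma new_customersS c b :
  new_customers S c b.+1 = new_customers S c.+1 b ++ [:: (c, S c)].
Proof.
rewrite /new_customers -[b.+1]/(1 + b)%N iotaD map_cat rev_cat /= addn0 rev_cons /=.
rewrite (iotaDl 1 0) -map_comp; congr (rev _ ++ _).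
by apply: eq_map => i /=; rewrite !addSnnS.
Qed.

(** The stack below is arbitrary because the recursion never looks under the customer in service.
    The count is required for every customer already labelled, since a sub-busy period must be shown
    to add nothing to the counts of those waiting below. *)
Definition serve_sound (sv : R -> input -> outcome) : Prop :=
  forall st id r rest, q_stack st = (id, r) :: rest -> (id < q_next_id st)%N ->
  let rho := sv r (residual st) in ok rho ->
  exists n, let st' := iter n step st in
  [/\ q_stack st' = rest, residual st' = rho.2, (q_next_id st <= q_next_id st')%N,
      peak st n = (size rest + height rho)%N &
      forall id', (id' < q_next_id st)%N ->
        arrival_count id' st n = if id' == id then arrivals rho else 0%N].

(** The batch has already been pushed, so [residual st] is past its service times; starting [S] at
    [c] puts them back. The label [(c + b).-1] is the last of the batch, hence the first to be
    served. *)
Lemma batch_sound sv : serve_sound sv -> forall b c st rest,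
  q_stack st = new_customers S c b ++ rest -> q_next_id st = (c + b)%N ->
  let rho := batch sv b ((residual st).1, fun i => S (c + i)%N) in ok rho ->
  exists n, let st' := iter n step st in
  [/\ q_stack st' = rest, residual st' = rho.2, (q_next_id st <= q_next_id st')%N,
      peak st n = (size rest + height rho)%N &
      (forall id', (id' < c)%N -> arrival_count id' st n = 0%N) /\
      ((0 < b)%N -> arrival_count (c + b).-1 st n = arrivals rho)].
Proof.
move=> svP; elim=> [|b IH] c st rest Hst Hid.
  move=> /= _; exists 0%N; split => //=.
  - by rewrite /residual Hid addn0.
  - by rewrite peak0 Hst addn0.
rewrite /=.
set xi1 := tailS _.
have xi1E : xi1 = ((residual st).1, fun i => S (c.+1 + i)%N).
  by rewrite /xi1 /tailS /=; congr pair; apply/funext => i; rewrite /stail addSnnS.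
rewrite xi1E /svc /= addn0.
move: Hst; rewrite new_customersS -catA /= => Hst.
have Hid' : q_next_id st = (c.+1 + b)%N by rewrite Hid addSnnS.
set rho1 := batch _ _ _ => /andP[ok1].
have [n1 [/= st1 res1 id1 pk1 [cnt1 cnt1']]] := IH _ _ _ Hst Hid' ok1.
set rho2 := sv _ _ => ok2.
have lt2 : (c < q_next_id (iter n1 step st))%N by lia.
have := svP _ _ _ _ st1 lt2; rewrite res1 => /(_ ok2)[n2 [/= st2 res2 id2 pk2 cnt2]].
exists (n2 + n1)%N; rewrite iterD; split => //.
- lia.
- by rewrite (addnC n2) peakD pk1 pk2 /= addSnnS -addn_maxr.
- split=> [id' lt_id'|_].
    rewrite (addnC n2) arrival_countD cnt1; last lia.
    by rewrite cnt2; [case: eqP => //; lia|lia].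
  rewrite addnS [(_.+1).-1]/= (addnC n2) arrival_countD.
  rewrite cnt2; last lia.
  transitivity (if (b == 0)%N then arrivals rho2 else arrivals rho1); last by [].
  (* For [b = 0] the bottom customer is itself the first one served; otherwise its label [c] differs
     from the tracked [c + b] and its own service adds nothing. *)
  case: (posnP b) => [b0|b0]; rewrite -/rho1.
    by rewrite cnt1 ?b0 ?addn0 // eqxx.
  have -> : (c + b == c)%N = false by apply/eqP; lia.
  by rewrite (cnt1' b0) addn0.
Qed.

Lemma serve_is_sound m : serve_sound (serve m).
Proof.
elim: m => [|m IH] st id r rest Hst Hid //=.
have cond : (r <= arrival_time A (q_next_batch st) - q_time st) =
   (q_time st + r <= arrival_time A (q_next_batch st)).
  by rewrite lerBrDl.
rewrite cond; case: ifPn => Hr.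
  move=> _; exists 1%N => /=; rewrite /step Hst Hr /=; split => //.
  - by rewrite /residual /elapse /consA /tailA /gap /= opprD addrA.
  - by rewrite peakS peak0 /step Hst Hr /= addn1; lia.
  - by move=> id' _; rewrite arrival_countS /= /arrival_during Hst Hr andbF; case: ifP.
set st1 := step st.
have st1E : st1 = QState (arrival_time A (q_next_batch st))
        (new_customers S (q_next_id st) (B (q_next_batch st))
           ++ (id, r - (arrival_time A (q_next_batch st) - q_time st)) :: rest)
        (q_next_batch st).+1 (q_next_id st + B (q_next_batch st))%N.
  by rewrite /st1 /step Hst (negbTE Hr).
(* The clock now stands at the arrival epoch, so the residual gap is the whole next gap. The service
   times still start at the old [q_next_id], because the new batch has yet to draw its own. *)
have resE : tailB (tailA (residual st)) = ((residual st1).1, fun i => S (q_next_id st + i)%N).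
  rewrite st1E /tailB /tailA /residual /stail /=; congr (_, _, _); last first.
    by apply/funext => i; rewrite addSnnS.
  apply/funext => -[|i] /=; last by rewrite -addSnnS.
  rewrite addn1 /arrival_time (big_nat_recr (q_next_batch st).+1) //=.
  by rewrite addrAC subrr add0r.
rewrite resE /bsize /= addn0.
set b := B _; set rho1 := batch _ _ _.
move=> /andP[ok1].
have Hst1 : q_stack st1 = new_customers S (q_next_id st) b ++
   (id, r - (arrival_time A (q_next_batch st) - q_time st)) :: rest by rewrite st1E.
have Hid1 : q_next_id st1 = (q_next_id st + b)%N by rewrite st1E.
have [n1 [/= st1' res1 id1 pk1 [cnt1 _]]] := @batch_sound _ IH _ _ _ _ Hst1 Hid1 ok1.
have lt2 : (id < q_next_id (iter n1 step st1))%N by lia.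
have := IH _ _ _ _ st1' lt2; rewrite res1 -/rho1 => Hr2 ok2.
have [n2 [/= st2 res2 id2 pk2 cnt2]] := Hr2 ok2.
exists (n2 + n1.+1)%N; rewrite iterD iterSr; split => //.
- by rewrite -/st1; lia.
(* The term [l.+1] is the state just before the preemption; it is absorbed by the sub-busy period,
   whose peak is counted on top of those [l.+1] customers. *)
- have maxE l a c : maxn l.+1 (maxn (l.+1 + a) (l + c)) = (l + maxn a.+1 c)%N by lia.
  rewrite (addnC n2) peakD peakS pk1 iterSr pk2 Hst -maxnA; exact: maxE.
- move=> id' lt'; rewrite (addnC n2) arrival_countD arrival_countS cnt1 // iterSr cnt2; last by lia.
  rewrite /arrival_during Hst Hr andbT addn0 [id == id']eq_sym.
  by case: eqP.
Qed.

(** Once the stack is empty [step] is the identity, so both suprema over all event counts are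
    attained within the finitely many events given by [batch_sound]. *)
Lemma busy_period_sound m k :
  let rho := batch (serve m) k ((residual (init_state S k)).1, S) in ok rho ->
  busy_max A B S k = (height rho)%:R%:E /\
  ((0 < k)%N -> serv0_arrivals A B S k = (arrivals rho)%:R%:E).
Proof.
move=> rho okr.
have Hst : q_stack (init_state S k) = new_customers S 0 k ++ [::] by rewrite cats0.
have [n [/= stn _ _ pk [_ cn]]] :=
  @batch_sound _ (serve_is_sound m) k 0%N _ [::] Hst (esym (add0n k)) okr.
have abs i : iter (n + i) step (init_state S k) = iter n step (init_state S k).
  elim: i => [|i IH]; first by rewrite addn0.
  by rewrite addnS iterS IH {1}/step stn.
split.
  apply/eqP; rewrite eq_le; apply/andP; split.
    apply: ub_ereal_sup => _ [i _ <-]; rewrite lee_fin ler_nat.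
    rewrite -[height rho]add0n -[X in (_ <= X)%N]pk.
    have [lein|ltni] := leqP i n.
      have ltin : (i < n.+1)%N by [].
      by rewrite /peak (bigD1 (Ordinal ltin)) //= leq_maxl.
    by rewrite /traj -(subnKC (ltnW ltni)) abs stn.
  have [i Hi] : exists i : 'I_n.+1, height rho = size (q_stack (iter i step (init_state S k))).
    have := @bigop.eq_bigmax _ (fun i : 'I_n.+1 => size (q_stack (iter i step (init_state S k)))).
    rewrite card_ord => /(_ isT)[i Hi]; exists i.
    by rewrite -Hi -[RHS]/(peak _ _) pk.
  by apply: ereal_sup_ubound; exists (nat_of_ord i) => //; rewrite Hi.
move=> k0; move: (cn k0); rewrite add0n => {}cn.
apply/eqP; rewrite eq_le; apply/andP; split.
  apply: ub_ereal_sup => _ [i _ <-]; rewrite lee_fin ler_nat -[X in (_ <= X)%N]cn.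
  rewrite -[arrivals_during_cust0 _ _ _ _ _]/(arrival_count k.-1 (init_state S k) i).
  have [lein|ltni] := leqP i n.
    by rewrite -(subnKC lein) arrival_countD leq_addr.
  rewrite -(subnKC (ltnW ltni)) arrival_countD.
  rewrite [X in (_ + X)%N](_ : _ = 0%N) ?addn0 //.
  rewrite /arrival_count (@eq_count _ _ xpred0) ?count_pred0 // => j.
  by rewrite -iterD addnC abs /arrival_during stn.
by apply: ereal_sup_ubound; exists n => //; rewrite -cn.
Qed.

End Link.
End BigStep.

(** * Random inputs *)

Section InputSpace.
Set Implicit Arguments.
Unset Strict Implicit.
Context {R : realType}.

Definition rect (n : nat) (a : nat -> set R) (b : nat -> set nat)
    (s : nat -> set R) : set (@input R) :=
  [set xi | forall i, (i < n)%N -> [/\ a i (xi.1.1 i), b i (xi.1.2 i) & s i (xi.2 i)]].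

(** The finite-dimensional cylinders, a pi-system generating the product sigma-algebra. The sets of
    batch sizes are arbitrary because [nat] is discrete. *)
Definition rects : set (set (@input R)) :=
  [set V | exists n a b s, [/\ forall i, measurable (a i),
     forall i, measurable (s i) & V = rect n a b s]].

Definition Xi := g_sigma_algebraType rects.

HB.instance Definition _ := Measurable.on Xi.

Lemma rects_setI : setI_closed rects.
Proof.
move=> _ _ [n1 [a1 [b1 [s1 [ma1 ms1 ->]]]]] [n2 [a2 [b2 [s2 [ma2 ms2 ->]]]]].
exists (maxn n1 n2).
exists (fun i => (if (i < n1)%N then a1 i else setT) `&` (if (i < n2)%N then a2 i else setT)).
exists (fun i => (if (i < n1)%N then b1 i else setT) `&` (if (i < n2)%N then b2 i else setT)).
exists (fun i => (if (i < n1)%N then s1 i else setT) `&` (if (i < n2)%N then s2 i else setT)).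
split=> [i|i|].
- by apply: measurableI; case: ifP.
- by apply: measurableI; case: ifP.
apply/seteqP; split=> xi /=.
  move=> [h1 h2] i _; case: (ltnP i n1) => i1; case: (ltnP i n2) => i2;
  by try (have [? ? ?] := h1 _ i1); try (have [? ? ?] := h2 _ i2); split; split.
move=> h; split=> i ilt.
  have /h : (i < maxn n1 n2)%N by rewrite leq_max ilt.
  by rewrite ilt => -[[? _] [? _] [? _]].
have /h : (i < maxn n1 n2)%N by rewrite leq_max ilt orbT.
by rewrite ilt => -[[_ ?] [_ ?] [_ ?]].
Qed.

Lemma rects_setT : rects setT.
Proof.
exists 0%N, (fun=> setT), (fun=> setT), (fun=> setT); split => //.
by apply/seteqP; split.
Qed.

Lemma measurable_rect n a b s : (forall i, measurable (a i)) ->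
  (forall i, measurable (s i)) -> measurable (rect n a b s : set Xi).
Proof. by move=> ma ms; apply: sub_sigma_algebra; exists n, a, b, s. Qed.

Lemma Xi_measure_unique (m1 m2 : {measure set Xi -> \bar R}) :
  (m1 setT < +oo)%E ->
  (forall n a b s, (forall i, measurable (a i)) -> (forall i, measurable (s i)) ->
     m1 (rect n a b s) = m2 (rect n a b s)) ->
  forall V : set Xi, measurable V -> m1 V = m2 V.
Proof.
move=> fin eqr V mV.
apply: (@g_sigma_algebra_measure_unique _ R Xi rects _ (fun=> setT) _ _ m1 m2) => //.
- by move=> ? ?; exact: sub_sigma_algebra.
- by move=> _; exact: rects_setT.
- by rewrite bigcup_const.
- exact: rects_setI.
- by move=> _ [n [a [b [s [ma ms ->]]]]]; exact: eqr.
Qed.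

Section Measurability.
Context {d : measure_display} {T : measurableType d}.

Lemma measurable_to_Xi (f : T -> Xi) :
  (forall i, measurable_fun setT (fun t => (f t).1.1 i)) ->
  (forall i, measurable_fun setT (fun t => (f t).1.2 i)) ->
  (forall i, measurable_fun setT (fun t => (f t).2 i)) ->
  measurable_fun setT f.
Proof.
move=> mA mB mS; apply: (@measurability _ _ T Xi setT f rects) => //.
move=> _ [_ [n [a [b [s [ma ms ->]]]]] <-].
rewrite (_ : f @^-1` _ = \bigcap_i (if (i < n)%N then
   ((fun t => (f t).1.1 i) @^-1` a i `&` (fun t => (f t).1.2 i) @^-1` b i) `&`
   ((fun t => (f t).2 i) @^-1` s i) else setT)); last first.
  apply/seteqP; split=> t /= h i; last first.
    by move=> ilt; have := h i I; rewrite ilt => -[[]].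
  by move=> _; case: ifP => // /h[].
rewrite setTI; apply: bigcap_measurable => [|i _]; first by exists 0%N.
case: ifP => // _; apply: measurableI; first apply: measurableI.
- by rewrite -[X in measurable X]setTI; exact: mA.
- by rewrite -[X in measurable X]setTI; exact: mB.
- by rewrite -[X in measurable X]setTI; exact: mS.
Qed.

Lemma measurable_Xi_coords (f : T -> Xi) : measurable_fun setT f ->
  [/\ forall i, measurable_fun setT (fun t => (f t).1.1 i),
      forall i, measurable_fun setT (fun t => (f t).1.2 i) &
      forall i, measurable_fun setT (fun t => (f t).2 i)].
Proof.
move=> mf; split=> i _ Y mY; rewrite setTI.
- rewrite (_ : _ @^-1` Y = f @^-1` rect i.+1 (fun j => if j == i then Y else setT)
     (fun=> setT) (fun=> setT)).
    by rewrite -[X in measurable X]setTI; apply: mf => //; apply: measurable_rect => // j; case: ifP.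
  apply/seteqP; split=> t /= h; last by have [] := h i (ltnSn i); rewrite eqxx.
  by move=> j _; split => //; case: eqP => // ->.
- rewrite (_ : _ @^-1` Y = f @^-1` rect i.+1 (fun=> setT)
     (fun j => if j == i then Y else setT) (fun=> setT)).
    by rewrite -[X in measurable X]setTI; apply: mf => //; apply: measurable_rect => // j; case: ifP.
  apply/seteqP; split=> t /= h; last by have [] := h i (ltnSn i); rewrite eqxx.
  by move=> j _; split => //; case: eqP => // ->.
- rewrite (_ : _ @^-1` Y = f @^-1` rect i.+1 (fun=> setT) (fun=> setT)
     (fun j => if j == i then Y else setT)).
    by rewrite -[X in measurable X]setTI; apply: mf => //; apply: measurable_rect => // j; case: ifP.
  apply/seteqP; split=> t /= h; last by have [] := h i (ltnSn i); rewrite eqxx.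
  by move=> j _; split => //; case: eqP => // ->.
Qed.

(** The preimage splits over the countably many values of [b]; this is what allows batch sizes,
    indices and labels to be random. *)
Lemma measurable_natcase {d'} {U : measurableType d'} (b : T -> nat) (f : nat -> T -> U) :
  measurable_fun setT b -> (forall n, measurable_fun setT (f n)) ->
  measurable_fun setT (fun t => f (b t) t).
Proof.
move=> mb mf _ Y mY; rewrite setTI.
rewrite (_ : _ @^-1` Y = \bigcup_n (b @^-1` [set n] `&` f n @^-1` Y)); last first.
  apply/seteqP; split=> t /=; first by exists (b t).
  by case=> n _ [/= <-].
apply: bigcupT_measurable => n; apply: measurableI.
  by rewrite -[X in measurable X]setTI; exact: mb.
by rewrite -[X in measurable X]setTI; exact: mf.
Qed.

Lemma measurable_consA (a : T -> R) (f : T -> Xi) : measurable_fun setT a ->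
  measurable_fun setT f -> measurable_fun setT (fun t => consA (a t) (f t) : Xi).
Proof.
move=> ma /measurable_Xi_coords[mA mB mS].
by apply: measurable_to_Xi => // -[|i] /=.
Qed.

Lemma measurable_consB (b : T -> nat) (f : T -> Xi) : measurable_fun setT b ->
  measurable_fun setT f -> measurable_fun setT (fun t => consB (b t) (f t) : Xi).
Proof.
move=> mb /measurable_Xi_coords[mA mB mS].
by apply: measurable_to_Xi => // -[|i] /=.
Qed.

Lemma measurable_consS (s : T -> R) (f : T -> Xi) : measurable_fun setT s ->
  measurable_fun setT f -> measurable_fun setT (fun t => consS (s t) (f t) : Xi).
Proof.
move=> ms /measurable_Xi_coords[mA mB mS].
by apply: measurable_to_Xi => // -[|i] /=.
Qed.

Lemma measurable_tailA (f : T -> Xi) :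
  measurable_fun setT f -> measurable_fun setT (fun t => tailA (f t) : Xi).
Proof.
by move=> /measurable_Xi_coords[mA mB mS]; apply: measurable_to_Xi => [i|//|//]; exact: (mA i.+1).
Qed.

Lemma measurable_tailB (f : T -> Xi) :
  measurable_fun setT f -> measurable_fun setT (fun t => tailB (f t) : Xi).
Proof.
by move=> /measurable_Xi_coords[mA mB mS]; apply: measurable_to_Xi => [//|i|//]; exact: (mB i.+1).
Qed.

Lemma measurable_tailS (f : T -> Xi) :
  measurable_fun setT f -> measurable_fun setT (fun t => tailS (f t) : Xi).
Proof.
by move=> /measurable_Xi_coords[mA mB mS]; apply: measurable_to_Xi => [//|//|i]; exact: (mS i.+1).
Qed.

Lemma measurable_gap (f : T -> Xi) :
  measurable_fun setT f -> measurable_fun setT (fun t => gap (f t)).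
Proof. by move=> /measurable_Xi_coords[mA mB mS]; exact: mA. Qed.

Lemma measurable_bsize (f : T -> Xi) :
  measurable_fun setT f -> measurable_fun setT (fun t => bsize (f t)).
Proof. by move=> /measurable_Xi_coords[mA mB mS]; exact: mB. Qed.

Lemma measurable_svc (f : T -> Xi) :
  measurable_fun setT f -> measurable_fun setT (fun t => svc (f t)).
Proof. by move=> /measurable_Xi_coords[mA mB mS]; exact: mS. Qed.

Definition measurable_outcome (f : T -> @outcome R) : Prop :=
  [/\ measurable_fun setT (fun t => ok (f t)),
      measurable_fun setT (fun t => height (f t)),
      measurable_fun setT (fun t => arrivals (f t)) &
      measurable_fun setT (fun t => (f t).2 : Xi)].

End Measurability.

(** Both arguments are random over an arbitrary space because the recursion calls the server with a
    random remaining service and with the random input left by the preceding call. *)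
Definition measurable_server (sv : R -> @input R -> outcome) : Prop :=
  forall d (T : measurableType d) (r : T -> R) (x : T -> Xi),
  measurable_fun setT r -> measurable_fun setT x ->
  measurable_outcome (fun t => sv (r t) (x t)).

Lemma measurable_natS {d} {T : measurableType d} (f : T -> nat) :
  measurable_fun setT f -> measurable_fun setT (fun t => (f t).+1).
Proof. by move=> mf; exact: (@measurableT_comp _ _ _ _ _ _ S). Qed.

Lemma measurable_batch sv : measurable_server sv ->
  forall b d (T : measurableType d) (x : T -> Xi),
  measurable_fun setT x -> measurable_outcome (fun t => batch sv b (x t)).
Proof.
move=> msv; elim=> [|b IH] d T x mx; first by split => //=; exact: measurable_cst.
have [mo1 mh1 mn1 mx1] := IH _ _ _ (measurable_tailS mx).
have [mo2 mh2 mn2 mx2] := msv _ _ _ _ (measurable_svc mx) mx1.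
split => //=.
- exact: measurable_and.
- by apply: measurable_fun_maxn => //; exact: measurable_natS.
- by case: b {IH mo1 mh1 mx1 mo2 mh2 mx2} mn1 mn2.
Qed.

Lemma measurable_batch_nat sv : measurable_server sv ->
  forall d (T : measurableType d) (b : T -> nat) (x : T -> Xi),
  measurable_fun setT b ->
  measurable_fun setT x -> measurable_outcome (fun t => batch sv (b t) (x t)).
Proof.
move=> msv d T b x mb mx; split.
- by apply: (@measurable_natcase _ _ _ _ b (fun b t => ok (batch sv b (x t)))) => // n;
    case: (@measurable_batch _ msv n _ _ _ mx).
- by apply: (@measurable_natcase _ _ _ _ b (fun b t => height (batch sv b (x t)))) => // n;
    case: (@measurable_batch _ msv n _ _ _ mx).
- by apply: (@measurable_natcase _ _ _ _ b (fun b t => arrivals (batch sv b (x t)))) => // n;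
    case: (@measurable_batch _ msv n _ _ _ mx).
- by apply: (@measurable_natcase _ _ _ _ b (fun b t => (batch sv b (x t)).2 : Xi)) => // n;
    case: (@measurable_batch _ msv n _ _ _ mx).
Qed.

Lemma measurable_serve m : measurable_server (serve m).
Proof.
elim: m => [|m IH] d T r x mr mx; first by split => //; exact: measurable_cst.
have mg := measurable_gap mx.
have mt := measurable_tailB (measurable_tailA mx).
have [mo1 mh1 mn1 mx1] := measurable_batch_nat IH (measurable_bsize mx) mt.
have [mo2 mh2 mn2 mx2] := IH _ _ _ _ (measurable_funB mr mg) mx1.
have mle : measurable_fun setT (fun t => r t <= gap (x t)) by exact: measurable_fun_ler.
split => /=.
- under eq_fun do rewrite (fun_if (@ok R)).
  by apply: measurable_fun_ifT => //; exact: measurable_and.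
- under eq_fun do rewrite (fun_if (@height R)).
  by apply: measurable_fun_ifT => //; apply: measurable_fun_maxn => //; exact: measurable_natS.
- under eq_fun do rewrite (fun_if (@arrivals R)).
  by apply: measurable_fun_ifT => //; exact: measurable_natS.
- under eq_fun do rewrite (fun_if snd).
  apply: measurable_fun_ifT => //; apply: measurable_consA; first exact: measurable_funB.
  exact: measurable_tailA.
Qed.

End InputSpace.

(** * Product law of the input and memorylessness of the gaps *)

Section Law.
Set Implicit Arguments.
Unset Strict Implicit.
Context {R : realType}.

Lemma ge0_integral_nonneg_support (nu : {measure set R -> \bar R})
    (f : R -> \bar R) :
  nu `]-oo, 0[%classic = 0%E -> measurable_fun setT f -> (forall x, 0 <= f x)%E ->
  (\int[nu]_x f x = \int[nu]_(x in `[0%R, +oo[) f x)%E.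
Proof.
move=> nu0 mf f0; rewrite (@ge0_negligible_integral _ R R nu setT `]-oo, 0%R[%classic) //.
by rewrite setTD setCitvl.
Qed.

Variables (PP : probability (@Xi R) R) (nuA : probability R R)
  (nuB : probability nat R) (nuS : probability R R).

Definition input_law : Prop := forall n a b s, (forall i, measurable (a i)) ->
  (forall i, measurable (s i)) ->
  PP (rect n a b s) =
  (\prod_(i < n) (fine (nuA (a i)) * fine (nuB (b i)) * fine (nuS (s i))))%:E.

Hypothesis lawE : input_law.

(** Prepending an independent coordinate reproduces [PP]: this is checked on cylinders, extends to
    all measurable sets by uniqueness, and Tonelli then separates the new coordinate. *)
Lemma integral_cons {d} {T : measurableType d} (nu : probability T R)
    (c : T -> Xi -> Xi) (f : Xi -> \bar R) :
  measurable_fun setT (fun tx : T * Xi => c tx.1 tx.2) ->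
  (forall n a b s, (forall i, measurable (a i)) -> (forall i, measurable (s i)) ->
     (nu \x PP)%E ((fun tx : T * Xi => c tx.1 tx.2) @^-1` rect n a b s) = PP (rect n a b s)) ->
  measurable_fun setT f -> (forall x, 0 <= f x)%E ->
  (\int[PP]_x f x = \int[nu]_t \int[PP]_x f (c t x))%E.
Proof.
move=> mc crect mf f0.
have mfc : measurable_fun setT (fun tx : T * Xi => f (c tx.1 tx.2)).
  exact: (measurableT_comp mf mc).
rewrite -(@fubini_tonelli1 _ _ _ _ _ nu PP (fun tx => f (c tx.1 tx.2))) //.
rewrite -(@ge0_integral_pushforward _ _ _ _ _ _ mc (nu \x PP)%E setT f) //.
apply: eq_measure_integral => V mV _.
apply: (@Xi_measure_unique _ PP (pushforward (nu \x PP)%E (fun tx : T * Xi => c tx.1 tx.2))) => //.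
  by apply: (@le_lt_trans _ _ 1%E); [exact: probability_le1|exact: ltry].
by move=> n a b s ma ms; exact: (esym (crect n a b s ma ms)).
Qed.

Lemma prob_fineK {d} {T : measurableType d} (nu : probability T R) (V : set T) :
  measurable V -> ((fine (nu V))%:E = nu V)%E.
Proof. by move=> mV; rewrite fineK // fin_num_measure. Qed.

Let prod_rect {d} {T : measurableType d} (nu : probability T R) (V : set T) n a b s :
  measurable V -> (forall i, measurable (a i)) -> (forall i, measurable (s i)) ->
  (nu \x PP)%E (V `*` (rect n a b s : set Xi)) = (fine (nu V) *
    \prod_(i < n) (fine (nuA (a i)) * fine (nuB (b i)) * fine (nuS (s i))))%:E.
Proof.
move=> mV ma ms; rewrite product_measure1E //; last exact: measurable_rect.
by rewrite EFinM; congr (_ * _)%E; [rewrite prob_fineK|exact: lawE].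
Qed.

(** Prepending moves only one of the three families; the other two keep all [n.+1] constraints, so
    the tail cylinder keeps its length and its last slot is filled with [setT]. *)
Let shift {T : Type} n (a : nat -> set T) : nat -> set T :=
  fun i => if (i < n)%N then a i.+1 else setT.

Let prod_shift {d} {T : measurableType d} (nu : probability T R) n (a : nat -> set T) :
  \prod_(i < n.+1) fine (nu (a i)) =
  fine (nu (a 0%N)) * \prod_(i < n.+1) fine (nu (shift n a i)).
Proof.
rewrite big_ord_recl; congr (_ * _).
rewrite big_ord_recr /= {2}/shift ltnn probability_setT /= mulr1.
by apply: eq_bigr => i _; rewrite /shift ltn_ord.
Qed.

Lemma integral_consA (f : Xi -> \bar R) :
  measurable_fun setT f -> (forall x, 0 <= f x)%E ->
  (\int[PP]_x f x = \int[nuA]_t \int[PP]_x f (consA t x))%E.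
Proof.
apply: integral_cons => [|[|n] a b s ma ms].
- by apply: measurable_consA; [exact: measurable_fst|exact: measurable_snd].
- rewrite (_ : rect 0 a b s = setT :> set Xi); last by apply/seteqP; split.
  by rewrite preimage_setT !probability_setT.
- rewrite (_ : _ @^-1` _ = a 0%N `*` (rect n.+1 (shift n a) b s : set Xi)); last first.
    apply/seteqP; split=> -[t x] /= h.
      split; first by have [] := h 0%N isT.
      move=> i ilt; have [_ ? ?] := h i ilt; split => //.
      by rewrite /shift; case: ifP => // i'lt; have [] := h i.+1 i'lt.
    move=> i ilt; have [_ u v] := h.2 i ilt; split => //.
    case: i ilt {u v} => [|i] ilt; first exact: h.1.
    by have [] := h.2 i (ltnW ilt); rewrite /shift (_ : (i < n)%N).
  have ms' i : measurable (shift n a i) by rewrite /shift; case: ifP.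
  rewrite prod_rect // lawE //; congr EFin.
  by rewrite !big_split /= [in RHS](prod_shift nuA n a) !mulrA.
Qed.

Lemma integral_consB (f : Xi -> \bar R) :
  measurable_fun setT f -> (forall x, 0 <= f x)%E ->
  (\int[PP]_x f x = \int[nuB]_t \int[PP]_x f (consB t x))%E.
Proof.
apply: integral_cons => [|[|n] a b s ma ms].
- by apply: measurable_consB; [exact: measurable_fst|exact: measurable_snd].
- rewrite (_ : rect 0 a b s = setT :> set Xi); last by apply/seteqP; split.
  by rewrite preimage_setT !probability_setT.
- rewrite (_ : _ @^-1` _ = b 0%N `*` (rect n.+1 a (shift n b) s : set Xi)); last first.
    apply/seteqP; split=> -[t x] /= h.
      split; first by have [] := h 0%N isT.
      move=> i ilt; have [? _ ?] := h i ilt; split => //.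
      by rewrite /shift; case: ifP => // i'lt; have [] := h i.+1 i'lt.
    move=> i ilt; have [u _ v] := h.2 i ilt; split => //.
    case: i ilt {u v} => [|i] ilt; first exact: h.1.
    by have [] := h.2 i (ltnW ilt); rewrite /shift (_ : (i < n)%N).
  rewrite prod_rect // lawE //; congr EFin.
  by rewrite !big_split /= [in RHS](prod_shift nuB n b) [in RHS]mulrCA !mulrA.
Qed.

Lemma integral_consS (f : Xi -> \bar R) :
  measurable_fun setT f -> (forall x, 0 <= f x)%E ->
  (\int[PP]_x f x = \int[nuS]_t \int[PP]_x f (consS t x))%E.
Proof.
apply: integral_cons => [|[|n] a b s ma ms].
- by apply: measurable_consS; [exact: measurable_fst|exact: measurable_snd].
- rewrite (_ : rect 0 a b s = setT :> set Xi); last by apply/seteqP; split.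
  by rewrite preimage_setT !probability_setT.
- rewrite (_ : _ @^-1` _ = s 0%N `*` (rect n.+1 a b (shift n s) : set Xi)); last first.
    apply/seteqP; split=> -[t x] /= h.
      split; first by have [] := h 0%N isT.
      move=> i ilt; have [? ? _] := h i ilt; split => //.
      by rewrite /shift; case: ifP => // i'lt; have [] := h i.+1 i'lt.
    move=> i ilt; have [u v _] := h.2 i ilt; split => //.
    case: i ilt {u v} => [|i] ilt; first exact: h.1.
    by have [] := h.2 i (ltnW ilt); rewrite /shift (_ : (i < n)%N).
  have ms' i : measurable (shift n s i) by rewrite /shift; case: ifP.
  rewrite prod_rect // lawE //; congr EFin.
  by rewrite !big_split /= [in RHS](prod_shift nuS n s) [in RHS]mulrCA !mulrA.
Qed.

Local Open Scope ereal_scope.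

(** The event that the gap is at least [r] is implicit on the left, [V] lying in the nonnegative
    half line. *)
Definition memoryless_law : Prop := forall (r : R) (V : set R), (0 <= r)%R ->
  measurable V -> V `<=` `[0%R, +oo[%classic ->
  nuA ((fun a => a - r)%R @^-1` V) = nuA `[r, +oo[%classic * nuA V.

Hypothesis nuA_neg : nuA `]-oo, 0%R[%classic = 0.
Hypothesis memoryless : memoryless_law.

Lemma integral_memoryless (r : R) (g : R -> \bar R) : (0 <= r)%R ->
  measurable_fun setT g -> (forall x, 0 <= g x) ->
  \int[nuA]_(a in `[r, +oo[) g (a - r)%R = nuA `[r, +oo[%classic * \int[nuA]_a g a.
Proof.
move=> r0 mg g0.
rewrite (ge0_integral_nonneg_support _ mg) //.
have msub : measurable_fun setT (fun a : R => a - r)%R by exact: measurable_funB.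
rewrite (_ : `[r, +oo[%classic = (fun a => a - r)%R @^-1` `[0%R, +oo[%classic); last first.
  by apply/seteqP; split=> a /=; rewrite !in_itv /= !andbT subr_ge0.
rewrite -(@ge0_integral_pushforward _ _ _ _ _ _ msub nuA `[0%R, +oo[%classic g) //; last first.
  exact: measurable_funS mg.
set t := nuA _.
have t0 : (0 <= fine t)%R by apply: fine_ge0; exact: measure_ge0.
have tE : t = (NngNum t0)%:num%:E.
  rewrite /= fineK // fin_num_measure //.
  by rewrite -[X in measurable X]setTI; exact: msub.
rewrite tE -ge0_integral_mscale //; last exact: measurable_funS mg.
apply: eq_measure_integral => V mV V0.
rewrite /= /pushforward /mscale /= -[RHS]/((NngNum t0)%:num%:E * nuA V) -tE memoryless //.
congr (nuA _ * _).
by apply/seteqP; split=> a /=; rewrite !in_itv /= !andbT subr_ge0.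
Qed.

End Law.

(** * Regeneration at service completions *)

Section StrongMarkov.
Set Implicit Arguments.
Unset Strict Implicit.
Context {R : realType}.
Local Open Scope ereal_scope.

Implicit Types (x : \bar R) (D : pred nat) (rho : @outcome R).

(** Taking [x = +oo] or [D = xpredT] lifts a constraint, and [+oo - 1 = +oo] keeps it lifted along
    the recursion. *)
Definition good x D rho : bool :=
  [&& ok rho, (height rho)%:R%:E <= x & D (arrivals rho)].

Lemma maxn_le_ereal (a b : nat) x :
  ((maxn a b)%:R%:E <= x) = (a%:R%:E <= x) && (b%:R%:E <= x).
Proof.
case: (leqP a b) => ab; apply/idP/andP => [h|[]//]; split => //;
  by apply: le_trans h; rewrite lee_fin ler_nat // ltnW.
Qed.

Lemma succ_le_ereal (a : nat) x : ((a.+1)%:R%:E <= x) = (a%:R%:E <= x - 1).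
Proof. by rewrite leeBrDr // -EFinD natr1. Qed.

(** During the first part one more customer waits underneath, whence the bound [x - 1] there only.
    The splitting of [D] is left to the caller: in a batch one of the two parts carries the count,
    in a service the second part does, shifted by one. *)
Lemma good_follow x D D1 D2 rho1 rho2 n xi :
  D n = D1 (arrivals rho1) && D2 (arrivals rho2) ->
  good x D (ok rho1 && ok rho2, (maxn (height rho1).+1 (height rho2), n), xi) =
  good (x - 1) D1 rho1 && good x D2 rho2.
Proof.
move=> DE; rewrite /good /ok /height /arrivals /= -!/(ok _) -!/(height _) -!/(arrivals _) DE.
rewrite maxn_le_ereal succ_le_ereal.
by do !case: (_ <= _) => //=; case: ok => //=; case: ok => //=; rewrite ?andbF.
Qed.

(** A reward read off the input left over: letting [f] vary captures both the law of that input and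
    its independence of the event. *)
Definition pay x D rho (f : @Xi R -> \bar R) : \bar R :=
  if good x D rho then f rho.2 else 0.

Lemma pay_ge0 x D rho f : (forall xi, 0 <= f xi) -> 0 <= pay x D rho f.
Proof. by move=> f0; rewrite /pay; case: ifP. Qed.

Section Measurability.
Context {d} {T : measurableType d}.

Lemma measurable_good (o : T -> @outcome R) x D : measurable_outcome o ->
  measurable_fun setT (fun t => good x D (o t)).
Proof.
case=> mo mh mn _; rewrite /good.
apply: measurable_and => //; apply: measurable_and.
  by apply: (@measurableT_comp _ _ _ _ _ _ (fun h : nat => h%:R%:E <= x)).
exact: (@measurableT_comp _ _ _ _ _ _ D).
Qed.

Lemma measurable_pay (o : T -> @outcome R) x D (f : Xi -> \bar R) :
  measurable_outcome o -> measurable_fun setT f ->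
  measurable_fun setT (fun t => pay x D (o t) f).
Proof.
move=> mo mf; apply: measurable_fun_ifT; first exact: measurable_good.
  by case: mo => _ _ _ mo; exact: (measurableT_comp mf mo).
exact: measurable_cst.
Qed.

Lemma measurable_good_set (o : T -> @outcome R) x D : measurable_outcome o ->
  measurable [set t | good x D (o t)].
Proof.
move=> mo; rewrite -[X in measurable X]setTI.
by have := measurable_good x D mo measurableT (Y := [set true]); apply.
Qed.

Lemma integral_if_set (mu : {measure set T -> \bar R}) (b : T -> bool) :
  measurable [set t | b t] -> \int[mu]_t (if b t then 1 else 0) = mu [set t | b t].
Proof.
move=> mb; rewrite -[in RHS](setIT [set t | b t]) -integral_indic //.
apply: eq_integral => t _; rewrite indicE; case: (boolP (b t)) => bt.
  by rewrite mem_set.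
by rewrite memNset //=; exact/negP.
Qed.

End Measurability.

Lemma measurable_batch1 sv b : measurable_server sv ->
  measurable_outcome (fun xi : @Xi R => batch sv b xi).
Proof. by move=> ms; exact: measurable_batch. Qed.

Lemma measurable_server1 sv r : measurable_server sv ->
  measurable_outcome (fun xi : @Xi R => sv r xi).
Proof. by move=> ms; apply: ms. Qed.

Lemma measurable_server2 sv : measurable_server sv ->
  measurable_outcome (fun p : R * @Xi R => sv p.1 p.2).
Proof. by move=> ms; apply: ms. Qed.

Variables (PP : probability (@Xi R) R) (nuA : probability R R)
  (nuB : probability nat R) (nuS : probability R R).
Hypothesis lawE : input_law PP nuA nuB nuS.
Hypothesis nuA_neg : nuA `]-oo, 0%R[%classic = 0.
Hypothesis nuS_neg : nuS `]-oo, 0%R[%classic = 0.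
Hypothesis memoryless : memoryless_law nuA.

Definition prServe (sv : R -> @input R -> @outcome R) x D (r : R) : \bar R :=
  PP [set xi | good x D (sv r xi)].

Definition prBatch (sv : R -> @input R -> @outcome R) (b : nat) x D : \bar R :=
  PP [set xi | good x D (batch sv b xi)].

(* On [good x D (o xi)], the input left by [o] is independent of that event and
   distributed as the original input. *)
Definition regenerative (o : @Xi R -> @outcome R) : Prop :=
  forall x D f, measurable_fun setT f -> (forall xi, 0 <= f xi) ->
  \int[PP]_xi pay x D (o xi) f = PP [set xi | good x D (o xi)] * \int[PP]_xi f xi.

Lemma integral_one : \int[PP]_xi (cst 1 xi) = 1.
Proof. by rewrite integral_cst // mul1e; exact: probability_setT. Qed.

Lemma measurable_prServe sv x D : measurable_server sv ->
  measurable_fun setT (prServe sv x D).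
Proof.
move=> ms.
pose F (p : R * Xi) := pay x D (sv p.1 p.2) (cst 1).
have mF : measurable_fun setT F by apply: measurable_pay => //; exact: measurable_server2.
have F0 p : 0 <= F p by apply: pay_ge0.
have := measurable_fun_fubini_tonelli_F (m2 := PP) F mF F0.
congr (measurable_fun _ _); apply/funext => r.
rewrite /fubini_F /F /pay /prServe; apply: integral_if_set.
by apply: measurable_good_set; exact: measurable_server1.
Qed.

Definition avgServe sv x D : \bar R := \int[nuS]_s prServe sv x D s.

Lemma prServe_ge0 sv x D r : 0 <= prServe sv x D r.
Proof. exact: measure_ge0. Qed.

Lemma prBatch_ge0 sv b x D : 0 <= prBatch sv b x D.
Proof. exact: measure_ge0. Qed.

Lemma avgServe_ge0 sv x D : 0 <= avgServe sv x D.
Proof. by apply: integral_ge0 => s _; exact: prServe_ge0. Qed.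

Section Batch.
Variable sv : R -> @input R -> @outcome R.
Hypothesis ms : measurable_server sv.
Hypothesis reg : forall r, (0 <= r)%R -> regenerative (sv r).

(* Conditioning on the service time of the customer served last, which the other
   customers of the batch do not use. *)
Lemma batch_step b x D f : regenerative (batch sv b) ->
  measurable_fun setT f -> (forall xi, 0 <= f xi) ->
  \int[PP]_xi pay x D (batch sv b.+1 xi) f =
  prBatch sv b (x - 1) (if b == 0%N then xpredT else D) *
  avgServe sv x (if b == 0%N then D else xpredT) * \int[PP]_xi f xi.
Proof.
move=> regb mf f0.
(* Only the customer served first has its arrivals constrained; it is the bottom one exactly when
   nobody is above it. *)
set D1 := if _ then xpredT else D; set D2 := if _ then D else xpredT.
rewrite (integral_consS lawE); last 2 first.
- by apply: measurable_pay => //; exact: measurable_batch1.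
- by move=> xi; exact: pay_ge0.
have mg s : measurable_fun setT (fun xi : Xi => pay x D2 (sv s xi) f).
  by apply: measurable_pay => //; exact: measurable_server1.
(* With [s] split off, the service of the bottom customer is a payoff of the input left by the upper
   ones, to which [regb] applies. *)
transitivity (\int[nuS]_s \int[PP]_xi pay (x - 1) D1 (batch sv b xi)
    (fun xi1 => pay x D2 (sv s xi1) f)).
  apply: eq_integral => s _; apply: eq_integral => xi _.
  have tE : tailS (consS s xi) = xi by case: xi.
  rewrite {1}/pay /batch -/batch tE (@good_follow x D D1 D2); last first.
    by rewrite /D1 /D2; case: eqP => //= _; rewrite andbT.
  by rewrite /pay; case: good => //=.
transitivity (\int[nuS]_s (prBatch sv b (x - 1) D1 *
    \int[PP]_xi pay x D2 (sv s xi) f)).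
  by apply: eq_integral => s _; rewrite regb // => xi; exact: pay_ge0.
have mF : measurable_fun setT (fun s => \int[PP]_xi pay x D2 (sv s xi) f).
  apply: (measurable_fun_fubini_tonelli_F (m2 := PP) (fun p : R * Xi => pay x D2 (sv p.1 p.2) f)).
    by apply: measurable_pay => //; exact: measurable_server2.
  by move=> p; exact: pay_ge0.
rewrite ge0_integralZl //; last first.
  by move=> s _; apply: integral_ge0 => xi _; exact: pay_ge0.
rewrite -muleA; congr (_ * _).
have mv := measurable_prServe x D2 ms.
rewrite /avgServe -ge0_integralZr //; last exact: integral_ge0.
(* [reg] is available for nonnegative service times only; [nuS] does not charge the others. *)
rewrite ge0_integral_nonneg_support //; last first.
  by move=> s; apply: integral_ge0 => xi _; exact: pay_ge0.
rewrite [RHS]ge0_integral_nonneg_support //; last 2 first.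
- exact: emeasurable_funM.
- by move=> s; apply: mule_ge0; [exact: prServe_ge0|apply: integral_ge0].
by apply: eq_integral => s; rewrite inE /= in_itv /= andbT => s0; rewrite reg.
Qed.

Lemma prBatch0 x D : prBatch sv 0 x D = (if (0 <= x) && D 0%N then 1 else 0).
Proof.
rewrite /prBatch /good /= /ok /height /arrivals /=; case: ifP => h.
  rewrite (_ : [set _ | _] = setT) ?probability_setT //.
  by apply/seteqP; split.
rewrite (_ : [set _ | _] = set0) ?measure0 //.
by apply/seteqP; split.
Qed.

(** The factor in front of the integral in [batch_step] does not depend on [f]; the choice [f = 1]
    identifies it with the probability of the event. *)
Lemma batch_regenerative b : regenerative (batch sv b).
Proof.
elim: b => [|b IH] x D f mf f0.
  rewrite -/(prBatch sv 0 x D) prBatch0 /pay /good /= /ok /height /arrivals /=.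
  by case: ifP => _; rewrite ?mul1e // mul0e integral0.
rewrite batch_step //; congr (_ * _).
have := @batch_step b x D (cst 1) IH (@measurable_cst _ _ _ _ _ _) (fun=> lee01).
rewrite integral_one mule1 => <-.
rewrite /pay; apply: integral_if_set.
by apply: measurable_good_set; exact: measurable_batch1.
Qed.

Lemma prBatchS b x D : prBatch sv b.+1 x D =
  prBatch sv b (x - 1) (if b == 0%N then xpredT else D) *
  avgServe sv x (if b == 0%N then D else xpredT).
Proof.
have := @batch_step b x D (cst 1) (@batch_regenerative b) (@measurable_cst _ _ _ _ _ _) (fun=> lee01).
rewrite integral_one mule1 => <-.
rewrite /pay; apply/esym/integral_if_set.
by apply: measurable_good_set; exact: measurable_batch1.
Qed.

End Batch.

End StrongMarkov.

(** * Regeneration at the end of a single service *)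

Section Serve.
Set Implicit Arguments.
Unset Strict Implicit.
Context {R : realType}.
Local Open Scope ereal_scope.
Variables (PP : probability (@Xi R) R) (nuA : probability R R)
  (nuB : probability nat R) (nuS : probability R R).
Hypothesis lawE : input_law PP nuA nuB nuS.
Hypothesis nuA_neg : nuA `]-oo, 0%R[%classic = 0.
Hypothesis nuS_neg : nuS `]-oo, 0%R[%classic = 0.
Hypothesis memoryless : memoryless_law nuA.

Implicit Types (x : \bar R) (D : pred nat).

Definition avgBatch (sv : R -> @input R -> @outcome R) x D : \bar R :=
  \int[nuB]_b prBatch PP sv b x D.

Lemma avgBatch_ge0 sv x D : 0 <= avgBatch sv x D.
Proof. by apply: integral_ge0 => b _; exact: prBatch_ge0. Qed.

Definition survival (r : R) : \bar R := nuA `[r, +oo[%classic.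

Lemma measurable_consA1 a : measurable_fun setT (fun xi : @Xi R => consA a xi : Xi).
Proof. exact: measurable_consA. Qed.

(** Without arrival the customer alone has height 1, whence [1 <= x]. With a first arrival at
    [a < r], the batch sits above one customer ([x - 1]) and raises the count by one ([D \o S]). *)
Definition serveRate m x D (r : R) : \bar R :=
  (if (1 <= x) && D 0%N then survival r else 0) +
  avgBatch (serve m) (x - 1) xpredT *
  \int[nuA]_(a in `]-oo, r[) prServe PP (serve m) x (D \o S) (r - a).

(* Conditioning on the first gap [a]: if [r <= a] the customer leaves and the residual
   gap is again exponential; otherwise a batch is served and [r - a] remains. *)
Lemma serve_step m r x D f : (0 <= r)%R ->
  (forall s, (0 <= s)%R -> regenerative PP (serve m s)) ->
  measurable_fun setT f -> (forall xi, 0 <= f xi) ->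
  \int[PP]_xi pay x D (serve m.+1 r xi) f = serveRate m x D r * \int[PP]_xi f xi.
Proof.
move=> r0 reg mf f0.
have ms := @measurable_serve R m.
have mS := measurable_server1 r (@measurable_serve R m.+1).
have mpay : measurable_fun setT (fun xi : Xi => pay x D (serve m.+1 r xi) f).
  exact: measurable_pay.
rewrite (integral_consA lawE) //; last by move=> xi; exact: pay_ge0.
set G := fun a => \int[PP]_xi pay x D (serve m.+1 r (consA a xi)) f.
have mcA : measurable_fun setT (fun p : R * Xi => consA p.1 p.2 : Xi).
  by apply: measurable_consA; [exact: measurable_fst|exact: measurable_snd].
have mG : measurable_fun setT G.
  apply: (measurable_fun_fubini_tonelli_F (m2 := PP)
    (fun p : R * Xi => pay x D (serve m.+1 r (consA p.1 p.2)) f)).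
    exact: (measurableT_comp mpay mcA).
  by move=> p; exact: pay_ge0.
have G0 a : 0 <= G a by apply: integral_ge0 => xi _; exact: pay_ge0.
have intf0 : 0 <= \int[PP]_xi f xi by exact: integral_ge0.
have UE : [set: R] = `]-oo, r[%classic `|` `[r, +oo[%classic.
  apply/esym/seteqP; split=> // a _ /=; rewrite !in_itv /= andbT.
  by case: (leP r a) => h; [right|left].
rewrite UE ge0_integral_setU //; last 3 first.
- exact: measurable_funTS mG.
- by move=> a _; exact: G0.
- apply/disj_setPS => a /=; rewrite !in_itv /= andbT => -[ar ra].
  by move: (le_lt_trans ra ar); rewrite ltxx.
rewrite addeC /serveRate ge0_muleDl; last 2 first.
- by case: ifP => // _; exact: measure_ge0.
- by apply: mule_ge0; [exact: avgBatch_ge0|apply: integral_ge0 => a _; exact: prServe_ge0].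
congr (_ + _).
  pose g a := \int[PP]_xi f (consA a xi).
  have mg : measurable_fun setT g.
    apply: (measurable_fun_fubini_tonelli_F (m2 := PP) (fun p : R * Xi => f (consA p.1 p.2))) => //.
    exact: (measurableT_comp mf mcA).
  have g0 a : 0 <= g a by exact: integral_ge0.
  transitivity (\int[nuA]_(a in `[r, +oo[) (if (1 <= x) && D 0%N then g (a - r)%R else 0)).
    apply: eq_integral => a; rewrite inE /= in_itv /= andbT => ra.
    rewrite /G; transitivity (\int[PP]_xi (if (1 <= x) && D 0%N then f (consA (a - r)%R xi) else 0)).
      apply: eq_integral => xi _; rewrite /= {1}/gap /= ra /pay /good /ok /height /arrivals /=.
      by rewrite /elapse {1}/gap /=; case: xi => [[? ?] ?].
    by case: ifP => // _; rewrite integral0.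
  case: ifP => _; last by rewrite integral0 mul0e.
  by rewrite integral_memoryless // (integral_consA lawE mf).
pose h a := prServe PP (serve m) x (D \o S) (r - a)%R.
have mh : measurable_fun setT h.
  apply: (measurableT_comp (measurable_prServe PP x (D \o S) ms)).
  exact: measurable_funB.
have h0 a : 0 <= h a by exact: prServe_ge0.
transitivity (\int[nuA]_(a in `]-oo, r[)
    (avgBatch (serve m) (x - 1) xpredT * (h a * \int[PP]_xi f xi))).
  apply: eq_integral => a; rewrite inE /= in_itv /= => ar.
  rewrite /G (integral_consB lawE); last 2 first.
  - exact: (measurableT_comp mpay (measurable_consA1 a)).
  - by move=> xi; exact: pay_ge0.
  have mpay2 : measurable_fun setT (fun xi : Xi => pay x (D \o S) (serve m (r - a)%R xi) f).
    by apply: measurable_pay => //; exact: measurable_server1.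
  transitivity (\int[nuB]_b (prBatch PP (serve m) b (x - 1) xpredT * (h a * \int[PP]_xi f xi))).
    apply: eq_integral => b _.
    (* Two regenerations are used from right to left: that of the remaining own service, then that
       of the batch preceding it. *)
    rewrite -reg //; last by rewrite subr_ge0 ltW.
    rewrite -(@batch_regenerative _ PP nuA nuB nuS) // => [|xi]; last exact: pay_ge0.
    apply: eq_integral => xi _.
    have tE : tailB (tailA (consA a (consB b xi))) = xi by case: xi => [[? ?] ?].
    rewrite {1}/pay [serve _ _ _]/= {1 2}/gap /= leNgt ar /= -/(gap _) tE {1 2 3 4 5}/bsize /=.
    rewrite (@good_follow _ x D xpredT (D \o S)) //.
    by rewrite /pay; case: good.
  by rewrite ge0_integralZr //; exact: mule_ge0.
rewrite ge0_integralZl //; last 3 first.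
- by apply: measurable_funTS; exact: emeasurable_funM.
- by move=> a _; apply: mule_ge0.
- exact: avgBatch_ge0.
rewrite ge0_integralZr ?muleA //.
exact: measurable_funTS.
Qed.

Lemma serve_regenerative m r : (0 <= r)%R -> regenerative PP (serve m r).
Proof.
elim: m r => [|m IH] r r0 x D f mf f0.
  rewrite (_ : [set xi | _] = set0) ?measure0 ?mul0e; last by apply/seteqP; split.
  by rewrite /pay /good /= integral0.
rewrite serve_step //; congr (_ * _).
have := @serve_step m r x D (cst 1) r0 IH (@measurable_cst _ _ _ _ _ _) (fun=> lee01).
rewrite integral_one mule1 => <-.
rewrite /pay; apply: integral_if_set; apply: measurable_good_set.
exact: (measurable_server1 r (@measurable_serve R m.+1)).
Qed.

Lemma prServeS m x D r : (0 <= r)%R ->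
  prServe PP (serve m.+1) x D r = serveRate m x D r.
Proof.
move=> r0.
have := @serve_step m r x D (cst 1) r0 (@serve_regenerative m)
  (@measurable_cst _ _ _ _ _ _) (fun=> lee01).
rewrite integral_one mule1 => <-.
rewrite /pay; apply/esym; apply: integral_if_set; apply: measurable_good_set.
exact: (measurable_server1 r (@measurable_serve R m.+1)).
Qed.

Lemma prBatch_serveS m b x D : prBatch PP (serve m) b.+1 x D =
  prBatch PP (serve m) b (x - 1) (if b == 0%N then xpredT else D) *
  avgServe PP nuS (serve m) x (if b == 0%N then D else xpredT).
Proof.
apply: (prBatchS lawE nuS_neg) => [|r r0]; first exact: measurable_serve.
exact: serve_regenerative.
Qed.

End Serve.

(** * Arrivals during a service *)

Section Factorization.
Set Implicit Arguments.
Unset Strict Implicit.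
Context {R : realType}.
Local Open Scope ereal_scope.
Variables (PP : probability (@Xi R) R) (nuA : probability R R)
  (nuB : probability nat R) (nuS : probability R R).
Hypothesis lawE : input_law PP nuA nuB nuS.
Hypothesis nuA_neg : nuA `]-oo, 0%R[%classic = 0.
Hypothesis nuS_neg : nuS `]-oo, 0%R[%classic = 0.
Hypothesis memoryless : memoryless_law nuA.

Implicit Types (x : \bar R) (D : pred nat).

Local Notation F m x := (avgBatch PP nuB (serve m) x xpredT).

Fixpoint countLaw (n : nat) (r : R) : \bar R :=
  if n is n'.+1 then \int[nuA]_(a in `]-oo, r[) countLaw n' (r - a)%R
  else survival nuA r.

(* The probability that [n] successive sub-busy periods, the i-th with fuel [m - i],
   are completed with peak at most [x - 1]; [countLaw n r] is the probability of [n]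
   arrivals during [r] units of service. *)
Fixpoint countCoef (m n : nat) x : \bar R :=
  match m, n with
  | 0%N, _ => 0
  | _.+1, 0%N => if 1 <= x then 1 else 0
  | m'.+1, n'.+1 => F m' (x - 1) * countCoef m' n' x
  end.

Lemma countLaw_ge0 n r : 0 <= countLaw n r.
Proof. by elim: n r => [|n IH] r /=; [exact: measure_ge0|exact: integral_ge0]. Qed.

Lemma countCoef_ge0 m n x : 0 <= countCoef m n x.
Proof.
elim: m n => [|m IH] [|n] //=; first by case: ifP.
by apply: mule_ge0 => //; exact: avgBatch_ge0.
Qed.

Lemma countCoef_eq0 m n x : ~~ (1 <= x) -> countCoef m n x = 0.
Proof.
move=> /negbTE x1; elim: m n => [|m IH] [|n] //=; first by rewrite x1.
by rewrite IH mule0.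
Qed.

Lemma measurable_countLaw n : measurable_fun setT (countLaw n).
Proof.
elim: n => [|n IH].
  pose G (p : R * R) : \bar R := if (p.1 <= p.2)%R then 1 else 0.
  have mG : measurable_fun setT G.
    by apply: measurable_fun_ifT => //; apply: measurable_fun_ler;
      [exact: measurable_fst|exact: measurable_snd].
  have G0 p : 0 <= G p by rewrite /G; case: ifP.
  have := measurable_fun_fubini_tonelli_F (m2 := nuA) G mG G0.
  congr (measurable_fun _ _); apply/funext => r.
  have E : [set a | (r <= a)%R] = `[r, +oo[%classic.
    by apply/seteqP; split=> a /=; rewrite in_itv /= andbT.
  by rewrite /fubini_F /G /countLaw /survival -E; apply: integral_if_set; rewrite E.
pose G (p : R * R) : \bar R := if (p.2 < p.1)%R then countLaw n (p.1 - p.2)%R else 0.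
have mG : measurable_fun setT G.
  apply: measurable_fun_ifT => //.
    by apply: measurable_fun_ltr; [exact: measurable_snd|exact: measurable_fst].
  apply: (measurableT_comp IH).
  by apply: measurable_funB; [exact: measurable_fst|exact: measurable_snd].
have G0 p : 0 <= G p by rewrite /G; case: ifP => // _; exact: countLaw_ge0.
have := measurable_fun_fubini_tonelli_F (m2 := nuA) G mG G0.
congr (measurable_fun _ _); apply/funext => r /=.
rewrite [RHS]integral_mkcond; apply: eq_integral => a _.
by rewrite /G /patch /= mem_setE in_itv.
Qed.

Lemma prServe_false sv x D r : (forall n, D n = false) -> prServe PP sv x D r = 0.
Proof.
move=> D0; rewrite /prServe (_ : [set _ | _] = set0) ?measure0 //.
by apply/seteqP; split=> xi //=; rewrite /good D0 !andbF.
Qed.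

(** Separation of variables: a sub-busy period satisfies its height bound with a probability that
    does not depend on when it starts, so [x] enters only through [countCoef] and [r] only through
    [countLaw]. *)
Lemma prServe_count m n x r : (0 <= r)%R ->
  prServe PP (serve m) x (fun j => j == n) r = countCoef m n x * countLaw n r.
Proof.
elim: m n r => [|m IH] n r r0.
  rewrite /= mul0e /prServe (_ : [set _ | _] = set0) ?measure0 //.
  by apply/seteqP; split.
rewrite (prServeS lawE) // /serveRate; case: n => [|n].
  rewrite eqxx andbT [X in _ * X](_ : _ = 0) ?mule0 ?adde0 /=.
    by case: ifP; rewrite ?mul1e ?mul0e.
  apply: integral0_eq => a _; exact: prServe_false.
rewrite andbF add0e /= -muleA; congr (_ * _).
rewrite -ge0_integralZl //; last 3 first.
- apply: measurable_funTS; apply: (measurableT_comp (measurable_countLaw n)).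
  exact: measurable_funB.
- by move=> a _; exact: countLaw_ge0.
- exact: countCoef_ge0.
apply: eq_integral => a; rewrite inE /= in_itv /= => ar.
by rewrite -IH ?subr_ge0 ?ltW.
Qed.

Lemma countLaw_le1 n r : countLaw n r <= 1.
Proof.
elim: n r => [|n IH] r /=; first exact: probability_le1.
apply: (@le_trans _ _ (\int[nuA]_(a in `]-oo, r[) cst 1 a)); last first.
  by rewrite integral_cst // mul1e probability_le1.
apply: ge0_le_integral => //; first by move=> a _; exact: countLaw_ge0.
apply: measurable_funTS; apply: (measurableT_comp (measurable_countLaw n)).
exact: measurable_funB.
Qed.

(** The probability of [n] arrivals during one service; it cancels in [joint_law_factor]. *)
Definition avgCount n : \bar R := \int[nuS]_s countLaw n s.

Lemma avgCount_fin n : avgCount n \is a fin_num.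
Proof.
rewrite ge0_fin_numE; last by apply: integral_ge0 => s _; exact: countLaw_ge0.
apply: (@le_lt_trans _ _ (\int[nuS]_s cst 1 s)).
  apply: ge0_le_integral => //; first by move=> s _; exact: countLaw_ge0.
    exact: measurable_countLaw.
  by move=> s _; exact: countLaw_le1.
by rewrite integral_cst // mul1e (le_lt_trans (probability_le1 _ _)) ?ltry.
Qed.

Lemma avgServe_count m n x :
  avgServe PP nuS (serve m) x (fun j => j == n) = countCoef m n x * avgCount n.
Proof.
have mc := measurable_countLaw n.
rewrite /avgServe /avgCount -ge0_integralZl //; last 2 first.
- by move=> s _; exact: countLaw_ge0.
- exact: countCoef_ge0.
rewrite ge0_integral_nonneg_support //; last first.
  exact: (measurable_prServe PP x _ (@measurable_serve R m)).
rewrite [RHS]ge0_integral_nonneg_support //; last 2 first.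
- exact: emeasurable_funM.
- by move=> s; apply: mule_ge0; [exact: countCoef_ge0|exact: countLaw_ge0].
by apply: eq_integral => s; rewrite inE /= in_itv /= andbT => s0; rewrite prServe_count.
Qed.

Lemma prBatch_pred m b x : prBatch PP (serve m) b.+1 x xpredT =
  prBatch PP (serve m) b (x - 1) xpredT * avgServe PP nuS (serve m) x xpredT.
Proof. by rewrite (prBatch_serveS lawE) // !if_same. Qed.

(** Customer 0 is served on top of [k] others, hence the level [x - k]. Peeling off the bottom
    customer produces the same factor on both sides, since all customers of the batch are served
    with the same fuel; the identity is therefore exact for each [m]. *)
Lemma prBatch_count m n k x :
  prBatch PP (serve m) k.+1 x (fun j => j == n) =
  countCoef m n (x - k%:R%:E) * avgCount n * prBatch PP (serve m) k x xpredT.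
Proof.
elim: k x => [|k IH] x.
  rewrite (prBatch_serveS lawE) // eqxx avgServe_count sube0 !prBatch0 !andbT.
  (* The empty batch only asks for [0 <= x]; below level 1 [countCoef] vanishes anyway. *)
  rewrite muleC; have [x1|x1] := boolP (1 <= x).
    by rewrite sube_ge0 // x1 (le_trans lee01 x1).
  by rewrite countCoef_eq0 // !mul0e.
rewrite (prBatch_serveS lawE) // IH prBatch_pred muleA; congr (countCoef _ _ _ * _ * _ * _).
rewrite -addeA -oppeD //. by rewrite -EFinD nat1r.
Qed.

Lemma avgBatch_le1 m x D : avgBatch PP nuB (serve m) x D <= 1.
Proof.
apply: (@le_trans _ _ (\int[nuB]_b cst 1 b)); last first.
  by rewrite integral_cst // mul1e probability_le1.
apply: ge0_le_integral => // b _; apply: probability_le1.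
by apply: measurable_good_set; exact/measurable_batch1/measurable_serve.
Qed.

(** The [n] factors carry different fuels, but each differs from [m] by a fixed amount, so all have
    the same limit. *)
Lemma countCoef_cvg n x l : l \is a fin_num -> (F m (x - 1) @[m --> \oo] --> l) ->
  countCoef m n x @[m --> \oo] --> (if 1 <= x then l ^+ n else 0).
Proof.
move=> lfin Fl; elim: n => [|n IH]; rewrite -(cvg_shiftS (fun m => countCoef m _ x)) /=.
  exact: cvg_cst.
rewrite (_ : (if 1 <= x then l ^+ n.+1 else 0) = l * (if 1 <= x then l ^+ n else 0)).
  apply: cvgeM => //; apply: mule_def_fin => //; case: ifP => // _.
  by rewrite fin_numX.
by case: ifP => _; rewrite ?mule0 // expeS.
Qed.

End Factorization.

(** * Finiteness of busy periods *)

Section Exponential.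
Set Implicit Arguments.
Unset Strict Implicit.
Context {R : realType}.
Local Open Scope ereal_scope.
Variables (nuA : probability R R) (lam : R).
Hypothesis lam0 : (0 < lam)%R.
Hypothesis tailE : forall r : R, (0 <= r)%R -> nuA `[r, +oo[%classic = (expR (- lam * r))%:E.

Lemma exp_law_itvNyo (r : R) : (0 <= r)%R ->
  nuA `]-oo, r[%classic = (1 - expR (- lam * r))%:E.
Proof.
move=> r0; rewrite -setCitvr probability_setC // tailE //.
Qed.

Lemma exp_law_neg : nuA `]-oo, 0%R[%classic = 0.
Proof. by rewrite exp_law_itvNyo // mulr0 expR0 subrr. Qed.

Lemma exp_law_itvco (r : R) : (0 <= r)%R ->
  nuA `[0%R, r[%classic = (1 - expR (- lam * r))%:E.
Proof.
move=> r0; rewrite -exp_law_itvNyo //.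
rewrite (_ : `]-oo, r[%classic = `]-oo, 0%R[%classic `|` `[0%R, r[%classic); last first.
  apply/seteqP; split=> a /=; rewrite !in_itv /=.
    by move=> ->; rewrite andbT; case: (leP 0%R a) => h; [right|left].
  by case=> [a0|/andP[]//]; exact: lt_le_trans a0 r0.
rewrite measureU //; first by
  rewrite -[LHS]add0e; congr (_ + _); exact/esym/exp_law_neg.
apply/seteqP; split=> a //=; rewrite !in_itv /= => -[a0 /andP[a1 _]].
by move: (le_lt_trans a1 a0); rewrite ltxx.
Qed.

Lemma measure_eq_rays (m1 m2 : {measure set R -> \bar R}) : m1 setT < +oo ->
  (forall x : R, m1 `[x, +oo[%classic = m2 `[x, +oo[%classic) ->
  forall V, measurable V -> m1 V = m2 V.
Proof.
move=> fin eqr V mV.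
apply: (@g_sigma_algebra_measure_unique _ R R (@RGenCInfty.G R) _
  (fun n => `[- n%:R, +oo[%classic)%R _ _ m1 m2).
- by move=> _ [x ->].
- by move=> n; exists (- n%:R)%R.
- apply/seteqP; split=> // a _; exists (Num.truncn `|a|).+1 => //=.
  rewrite in_itv /= andbT lerNl; apply: le_trans (ler_norm _) _.
  by rewrite normrN ltW // truncnS_gt.
- move=> _ _ [x ->] [y ->]; exists (Num.max x y)%R.
  by apply/seteqP; split=> a /=; rewrite !in_itv /= !andbT ge_max => /andP.
- by move=> _ [x ->]; exact: eqr.
- move=> n; apply: le_lt_trans fin; apply: le_measure => //; rewrite inE //.
- rewrite -[X in X V]/((@RGenCInfty.G R).-sigma.-measurable).
  by rewrite -RGenCInfty.measurableE; exact: mV.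
Qed.

(** Both sides are measures restricted to the nonnegative half line, so it suffices to compare them
    on rays; a ray at [x] becomes one at [max x 0], and the exponential turns the shift by [r] into
    a factor. *)
Lemma exp_law_memoryless : memoryless_law nuA.
Proof.
move=> r V r0 mV V0.
have msub : measurable_fun setT (fun a : R => a - r)%R by exact: measurable_funB.
have e0 : (0 <= expR (- lam * r))%R := expR_ge0 _.
rewrite tailE // -[(expR _)%:E]/((NngNum e0)%:num%:E).
have mr : measurable (`[0%R, +oo[%classic : set R) by [].
have -> : nuA ((fun a => a - r)%R @^-1` V) =
   mrestr (pushforward nuA (fun a : R => a - r)%R) mr V.
  by rewrite /mrestr /pushforward setIidl.
have -> : (NngNum e0)%:num%:E * nuA V = mrestr (mscale (NngNum e0) nuA) mr V.
  by rewrite /mrestr /mscale /= setIidl.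
apply: (@measure_eq_rays (mrestr (pushforward nuA (fun a : R => a - r)%R) mr)
   (mrestr (mscale (NngNum e0) nuA) mr)) => //.
  rewrite /mrestr /pushforward /=; apply: (@le_lt_trans _ _ 1); last exact: ltry.
  apply: probability_le1; rewrite -[X in measurable X]setTI; apply: msub => //.
  exact: measurableI.
move=> x; rewrite /mrestr /pushforward /mscale /=.
have maxE : `[x, +oo[%classic `&` `[0%R, +oo[%classic = `[Num.max x 0%R, +oo[%classic :> set R.
  by apply/seteqP; split=> a /=; rewrite !in_itv /= !andbT ge_max => /andP.
have m0 : (0 <= Num.max x 0)%R by rewrite le_max lexx orbT.
transitivity (nuA `[(Num.max x 0 + r)%R, +oo[%classic).
  congr (nuA _); apply/seteqP; split=> a /=; rewrite !in_itv /= !andbT -lerBrDr ge_max => /andP //.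
transitivity ((expR (- lam * r))%:E * nuA `[Num.max x 0%R, +oo[%classic).
  rewrite !tailE ?addr_ge0 // -EFinM -expRD; congr (expR _)%:E.
  by rewrite mulrDr addrC.
by congr (_ * nuA _); rewrite -maxE.
Qed.

Local Notation leb := (@lebesgue_measure R).

Lemma integral_exp_density (r : R) : (0 < r)%R ->
  \int[leb]_(u in `[0%R, r]) (lam * expR (- lam * u))%:E = (1 - expR (- lam * r))%:E.
Proof.
move=> r0; rewrite EFinB -exponential_prob_itv0c //.
apply: eq_integral => u; rewrite inE /= in_itv /= => /andP[u0 _].
by rewrite exponential_pdfE.
Qed.

(** Adding the exponential density to the integrand gives the constant [lam]. *)
Lemma integral_exp_tail (r : R) : (0 < r)%R ->
  \int[leb]_(u in `[0%R, r]) (lam * (1 - expR (- lam * u)))%:E =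
  (lam * r - (1 - expR (- lam * r)))%:E.
Proof.
move=> r0.
have mexp : measurable_fun setT (fun u : R => (lam * expR (- lam * u))%:E).
  apply/measurable_EFinP; apply: measurable_funM => //.
  by apply: measurableT_comp => //; apply: measurable_funM.
have mexp' : measurable_fun setT (fun u : R => (lam * (1 - expR (- lam * u)))%:E).
  apply/measurable_EFinP; apply: measurable_funM => //; apply: measurable_funB => //.
  by apply: measurableT_comp => //; apply: measurable_funM.
have e1 u : (0 <= u)%R -> (expR (- lam * u) <= 1)%R.
  by move=> u0; rewrite -expR0 ler_expR mulNr oppr_le0 mulr_ge0 // ltW.
have : \int[leb]_(u in `[0%R, r]) ((lam * (1 - expR (- lam * u)))%:E + (lam * expR (- lam * u))%:E)
   = (lam * r)%:E.
  under eq_integral => u _ do rewrite -EFinD -mulrDr subrK mulr1.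
  rewrite integral_cst //= lebesgue_measure_itv /= lte_fin r0 -EFinB subr0.
  by rewrite -EFinM.
rewrite ge0_integralD //; last 4 first.
- move=> u; rewrite /= in_itv /= => /andP[u0 _].
  by rewrite lee_fin mulr_ge0 ?(ltW lam0) // subr_ge0 e1.
- exact: measurable_funTS.
- by move=> u _; rewrite lee_fin mulr_ge0 ?(ltW lam0) ?expR_ge0.
- exact: measurable_funTS.
rewrite integral_exp_density // => h.
by rewrite EFinB -h addeK.
Qed.

(* [phi r = lam * r] solves [phi r = \int (1 + phi (r - a))], the recursion that
   dominates the failure probability of a service (see [failServe_rec]). *)
Lemma exp_supersolution (r : R) : (0 <= r)%R ->
  \int[nuA]_(a in `[0%R, r[) (1 + lam * (r - a))%:E = (lam * r)%:E.
Proof.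
rewrite le_eqVlt => /predU1P[<-|r0].
  by rewrite mulr0 set_itvco0 integral_set0.
have r0' := ltW r0.
(* Since [r - a] is the length of []a, r]], Tonelli applied to this indicator turns the mean of
   [r - a] into the integral over [u] of the mass of [[0, u[], which is explicit. *)
pose G (p : R * R) : \bar R := if [&& 0 <= p.1, p.1 < p.2 & p.2 <= r]%R then 1 else 0.
have mG : measurable_fun setT G.
  apply: measurable_fun_ifT => //; apply: measurable_and.
    by apply: measurable_fun_ler => //; exact: measurable_fst.
  apply: measurable_and.
    by apply: measurable_fun_ltr; [exact: measurable_fst|exact: measurable_snd].
  by apply: measurable_fun_ler => //; exact: measurable_snd.
have G0 p : 0 <= G p by rewrite /G; case: ifP.
have Ga a : \int[leb]_u G (a, u) = (if (0 <= a < r)%R then (r - a)%:E else 0).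
  rewrite /G /=.
  have mab : measurable [set u : R | [&& 0 <= a, a < u & u <= r]%R].
    rewrite (_ : [set _ | _] = if (0 <= a)%R then `]a, r]%classic else set0); first by case: ifP.
    by apply/seteqP; split=> u /=; case: ifP => //= a0; rewrite in_itv.
  rewrite integral_if_set //.
  case: (boolP (0 <= a)%R) => a0 /=; last first.
    by rewrite (_ : [set _ | _] = set0) ?measure0 //; apply/seteqP; split.
  rewrite (_ : [set _ | _] = `]a, r]%classic); last first.
    by apply/seteqP; split=> u /=; rewrite in_itv.
  by rewrite lebesgue_measure_itv /= lte_fin; case: ifP.
have Gu u : \int[nuA]_a G (a, u) = (if (0 <= u <= r)%R then (1 - expR (- lam * u))%:E else 0).
  rewrite /G /=.
  have mab : measurable [set a : R | [&& 0 <= a, a < u & u <= r]%R].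
    rewrite (_ : [set _ | _] = if (u <= r)%R then `[0%R, u[%classic else set0); first by case: ifP.
    by apply/seteqP; split=> a /=; case: ifP => //= ur; rewrite ?in_itv /= ?andbT ?andbF.
  rewrite integral_if_set //.
  case: (boolP (u <= r)%R) => ur /=; last first.
    rewrite andbF (_ : [set _ | _] = set0) ?measure0 //.
    by apply/seteqP; split=> a //=; rewrite !andbF.
  rewrite andbT (_ : [set _ | _] = `[0%R, u[%classic); last first.
    by apply/seteqP; split=> a /=; rewrite in_itv /= andbT.
  case: (leP 0%R u) => u0; first by rewrite exp_law_itvco.
  by rewrite set_itv_ge ?measure0 // bnd_simp -leNgt ltW.
have swap := fubini_tonelli (m1 := nuA) (m2 := leb) G mG G0.
have E1 : \int[nuA]_(a in `[0%R, r[) (lam * (r - a))%:E = lam%:E * \int[nuA]_a \int[leb]_u G (a, u).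
  rewrite -ge0_integralZl //; last 3 first.
  - exact: (measurable_fun_fubini_tonelli_F (m2 := leb) G mG G0).
  - by move=> a _; apply: integral_ge0 => u _; exact: G0.
  - by rewrite lee_fin ltW.
  rewrite [LHS]integral_mkcond. apply: eq_integral => a _.
  by rewrite /patch mem_setE in_itv /= Ga; case: ifP => _; rewrite ?mule0.
have E2 : lam%:E * \int[leb]_u \int[nuA]_a G (a, u) =
    \int[leb]_(u in `[0%R, r]) (lam * (1 - expR (- lam * u)))%:E.
  rewrite -ge0_integralZl //; last 3 first.
  - exact: (measurable_fun_fubini_tonelli_G (m1 := nuA) G mG G0).
  - by move=> u _; apply: integral_ge0 => a _; exact: G0.
  - by rewrite lee_fin ltW.
  rewrite [RHS]integral_mkcond; apply: eq_integral => u _.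
  by rewrite /patch mem_setE in_itv /= Gu; case: ifP => _; rewrite ?mule0.
under eq_integral do rewrite EFinD.
rewrite ge0_integralD //; last 2 first.
- move=> a; rewrite /= in_itv /= => /andP[_ ar].
  by rewrite lee_fin mulr_ge0 ?(ltW lam0) // subr_ge0 ltW.
- apply: measurable_funTS; apply/measurable_EFinP; apply: measurable_funM => //.
  exact: measurable_funB.
rewrite E1 swap E2 integral_exp_tail // integral_cst // mul1e [X in X + _](exp_law_itvco r0').
by rewrite -EFinD addrC subrK.
Qed.

End Exponential.

(** * Failure probabilities with finite fuel *)

Section Stability.
Set Implicit Arguments.
Unset Strict Implicit.
Context {R : realType}.
Local Open Scope ereal_scope.

Lemma batch_mono (sv sv' : R -> input -> outcome) :
  (forall r xi, ok (sv r xi) -> sv' r xi = sv r xi) ->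
  forall b xi, ok (batch sv b xi) -> batch sv' b xi = batch sv b xi.
Proof.
move=> svE; elim=> [//|b IH] xi /= /andP[ok1 ok2].
by rewrite (IH _ ok1) (svE _ _ ok2).
Qed.

Lemma serveSE m (r : R) xi : serve m.+1 r xi =
  if (r <= gap xi)%R then (true, (1%N, 0%N), elapse r xi)
  else
    let rho1 := batch (serve m) (bsize xi) (tailB (tailA xi)) in
    let rho2 := serve m (r - gap xi)%R rho1.2 in
    (ok rho1 && ok rho2, (maxn (height rho1).+1 (height rho2), (arrivals rho2).+1), rho2.2).
Proof. by []. Qed.

(** An outcome that is [ok] never ran out of fuel in any nested call. This makes the failure
    probabilities nonincreasing in [m], so that they have limits. *)
Lemma serve_mono m (r : R) xi : ok (serve m r xi) -> serve m.+1 r xi = serve m r xi.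
Proof.
elim: m r xi => [//|m IH] r xi; rewrite (serveSE m.+1) (serveSE m r); cbv zeta.
by case: ifP => // _ /andP[ok1 ok2]; rewrite -!/(serve m.+1 _ _) (batch_mono IH ok1) (IH _ _ ok2).
Qed.

Variables (PP : probability (@Xi R) R) (nuA : probability R R)
  (nuB : probability nat R) (nuS : probability R R) (lam : R).
Hypothesis lawE : input_law PP nuA nuB nuS.
Hypothesis nuS_neg : nuS `]-oo, 0%R[%classic = 0.
Hypothesis lam0 : (0 < lam)%R.
Hypothesis tailE : forall r : R, (0 <= r)%R -> nuA `[r, +oo[%classic = (expR (- lam * r))%:E.

Let nuA_neg := exp_law_neg tailE.
Let memoryless := exp_law_memoryless tailE.

Local Notation F m := (avgBatch PP nuB (serve m) +oo xpredT).
Local Notation v m := (prServe PP (serve m) +oo xpredT).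

Definition failBatch m : R := 1 - fine (F m).
Definition failServe m (r : R) : R := 1 - fine (v m r).

Lemma prServe_le1 m r : v m r <= 1.
Proof.
apply: probability_le1; apply: measurable_good_set.
exact/measurable_server1/measurable_serve.
Qed.

Lemma prServe_fin m r : v m r \is a fin_num.
Proof. by rewrite ge0_fin_numE ?prServe_ge0 // (le_lt_trans (prServe_le1 m r)) ?ltry. Qed.

Lemma avgBatch_fin m : F m \is a fin_num.
Proof. by rewrite ge0_fin_numE ?avgBatch_ge0 // (le_lt_trans (avgBatch_le1 _ _ _ _ _)) ?ltry. Qed.

Lemma failServe_E m r : (failServe m r)%:E = 1 - v m r.
Proof. by rewrite /failServe EFinB fineK ?prServe_fin. Qed.

Lemma failBatch_E m : (failBatch m)%:E = 1 - F m.
Proof. by rewrite /failBatch EFinB fineK ?avgBatch_fin. Qed.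

Lemma failServe_ge0 m r : (0 <= failServe m r)%R.
Proof. by rewrite -lee_fin failServe_E sube_ge0 ?prServe_le1 ?prServe_fin. Qed.

Lemma failServe_le1 m r : (failServe m r <= 1)%R.
Proof. by rewrite /failServe gerBl fine_ge0 ?prServe_ge0. Qed.

Lemma failBatch_ge0 m : (0 <= failBatch m)%R.
Proof. by rewrite -lee_fin failBatch_E sube_ge0 ?avgBatch_le1 ?avgBatch_fin. Qed.

Lemma measurable_failServe m : measurable_fun setT (fun r => (failServe m r)%:E).
Proof.
under eq_fun do rewrite failServe_E.
apply: emeasurable_funB => //; apply: measurable_prServe; exact: measurable_serve.
Qed.

Lemma prServe_le_succ m r : v m r <= v m.+1 r.
Proof.
have mg k : measurable ([set xi | good +oo xpredT (serve k r xi)] : set (@Xi R)).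
  exact/measurable_good_set/measurable_server1/measurable_serve.
apply: le_measure; [exact: mem_set (mg _)|exact: mem_set (mg _)|].
move=> xi g; have E : serve m.+1 r xi = serve m r xi by apply: serve_mono; case/and3P: g.
exact: (eq_ind_r (fun o => good +oo xpredT o) g E).
Qed.

Lemma prBatch_le_succ m b : prBatch PP (serve m) b +oo xpredT <= prBatch PP (serve m.+1) b +oo xpredT.
Proof.
have mg k : measurable ([set xi | good +oo xpredT (batch (serve k) b xi)] : set (@Xi R)).
  exact/measurable_good_set/measurable_batch1/measurable_serve.
apply: le_measure; [exact: mem_set (mg _)|exact: mem_set (mg _)|].
move=> xi g; have E : batch (serve m.+1) b xi = batch (serve m) b xi.
  by apply: (batch_mono (@serve_mono m)); case/and3P: g.
exact: (eq_ind_r (fun o => good +oo xpredT o) g E).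
Qed.

Lemma avgBatch_le_succ m : F m <= F m.+1.
Proof.
by apply: ge0_le_integral => // b _; exact: prBatch_le_succ.
Qed.

Lemma failServe_nincr r : {homo failServe ^~ r : m n / (m <= n)%N >-> (n <= m)%R}.
Proof.
apply/nonincreasing_seqP => m.
by rewrite /failServe lerB // fine_le ?prServe_fin ?prServe_le_succ.
Qed.

Lemma failBatch_nincr : {homo failBatch : m n / (m <= n)%N >-> (n <= m)%R}.
Proof.
apply/nonincreasing_seqP => m.
by rewrite /failBatch lerB // fine_le ?avgBatch_fin ?avgBatch_le_succ.
Qed.

Lemma integral_nuA_itv (r : R) f : measurable_fun setT f -> (forall a, 0 <= f a) ->
  \int[nuA]_(a in `]-oo, r[) f a = \int[nuA]_(a in `[0%R, r[) f a.
Proof.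
move=> mf f0.
rewrite (@ge0_negligible_integral _ R R nuA `]-oo, r[%classic `]-oo, 0%R[%classic) //; last first.
  exact: measurable_funTS.
congr (integral _ _ _); apply/seteqP; split=> a /=; rewrite !in_itv /=.
  by move=> [-> /negP]; rewrite -leNgt => ->.
by move=> /andP[a0 ->]; split => //; apply/negP; rewrite -leNgt.
Qed.

(** Union bound: after a first arrival at [a], a failure comes from its batch or from the remaining
    service [r - a]. *)
Lemma failServe_rec m (r : R) : (0 <= r)%R ->
  (failServe m.+1 r)%:E <= \int[nuA]_(a in `[0%R, r[) (failBatch m + failServe m (r - a))%:E.
Proof.
move=> r0.
have msub : measurable_fun setT (fun a : R => r - a)%R by exact: measurable_funB.
have mfs : measurable_fun setT (fun a : R => (failServe m (r - a))%:E).
  exact: (measurableT_comp (measurable_failServe m) msub).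
have mh : measurable_fun setT (fun a : R => (failBatch m + failServe m (r - a))%:E).
  by under eq_fun do rewrite EFinD; exact: emeasurable_funD.
have h0 a : 0 <= (failBatch m + failServe m (r - a))%:E.
  by rewrite lee_fin addr_ge0 ?failBatch_ge0 ?failServe_ge0.
have mv : measurable_fun setT (fun a : R => v m (r - a)%R).
  apply: (measurableT_comp (measurable_prServe PP _ _ (@measurable_serve R m))) => //.
have mFv : measurable_fun setT (fun a : R => F m * v m (r - a)%R) by exact: emeasurable_funM.
have Fv0 a : 0 <= F m * v m (r - a)%R.
  by apply: mule_ge0; [exact: avgBatch_ge0|exact: prServe_ge0].
rewrite failServe_E leeBlDr ?prServe_fin // -integral_nuA_itv //.
have rateE : serveRate PP nuA nuB m +oo xpredT r =
    survival nuA r + F m * \int[nuA]_(a in `]-oo, r[) v m (r - a)%R.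
  by rewrite /serveRate leey.
rewrite (prServeS lawE) // rateE addeCA -ge0_integralZl //; last 2 first.
- exact: measurable_funTS.
- exact: avgBatch_ge0.
rewrite -ge0_integralD //; last 2 first.
- exact: measurable_funTS.
- exact: measurable_funTS.
(* The total mass is split at [r] so that the case without arrival cancels. *)
have -> : 1 = survival nuA r + \int[nuA]_(a in `]-oo, r[) cst 1 a.
  rewrite integral_cst // mul1e [X in _ + X](exp_law_itvNyo tailE r0) /survival tailE //.
  by rewrite -EFinD addrC subrK.
apply: leeD2l; apply: ge0_le_integral => //.
- by apply: measurable_funTS; exact: emeasurable_funD.
- move=> a _.
  have E : F m * v m (r - a)%R = ((1 - failBatch m) * (1 - failServe m (r - a)))%:E.
    by rewrite /failBatch /failServe !subKr EFinM !fineK ?avgBatch_fin ?prServe_fin.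
  rewrite E -EFinD lee_fin.
  have := failBatch_ge0 m; have := failServe_ge0 m (r - a).
  by nra.
Qed.

(* The last term bounds the probability of at least [j] arrivals within time [T]. *)
Lemma failServe_bound m (T : R) j (r : R) : (0 <= r <= T)%R ->
  (failServe (m + j) r <= failBatch m * (lam * r) + (1 - expR (- lam * T)) ^+ j)%R.
Proof.
set kap := (1 - _)%R.
have eT1 : (0 <= T)%R -> (0 <= kap)%R.
  by move=> T0; rewrite /kap subr_ge0 -expR0 ler_expR mulNr oppr_le0 mulr_ge0 // ltW.
(* [T] stays fixed while [r] shrinks to [r - a], which keeps [kap] the same throughout. For [j = 0]
   the last term is 1 and the bound is trivial. *)
elim: j r => [|j IH] r /andP[r0 rT].
  rewrite expr0 (le_trans (failServe_le1 _ _)) // lerDr.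
  by rewrite mulr_ge0 ?failBatch_ge0 // mulr_ge0 // ltW.
have T0 := le_trans r0 rT.
have k0 := eT1 T0.
rewrite -lee_fin addnS (le_trans (failServe_rec _ r0)) //.
have mlin : measurable_fun setT (fun a : R => (1 + lam * (r - a))%:E).
  apply/measurable_EFinP; apply: measurable_funD => //; apply: measurable_funM => //.
  exact: measurable_funB.
have mlin' : measurable_fun setT (fun a : R => (failBatch m * (1 + lam * (r - a)))%:E).
  by under eq_fun do rewrite EFinM; exact: emeasurable_funM.
have lin0 a : `[0%R, r[%classic a -> (0 <= 1 + lam * (r - a))%R.
  rewrite /= in_itv /= => /andP[_ ar].
  by rewrite addr_ge0 // mulr_ge0 ?(ltW lam0) // subr_ge0 ltW.
(* Monotonicity in the fuel replaces [failBatch (m + j)] by [failBatch m]. Then [exp_supersolution]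
   reproduces the linear term, and the constant [kap ^+ j] gains the mass of [[0, r[], at most
   [kap]. *)
apply: (@le_trans _ _ (\int[nuA]_(a in `[0%R, r[)
   ((failBatch m * (1 + lam * (r - a)))%:E + (kap ^+ j)%:E))).
  apply: ge0_le_integral => //.
  - by move=> a _; rewrite lee_fin addr_ge0 ?failBatch_ge0 ?failServe_ge0.
  - apply: measurable_funTS; under eq_fun do rewrite EFinD.
    apply: emeasurable_funD => //; apply: (measurableT_comp (measurable_failServe _)).
    exact: measurable_funB.
  - by apply: measurable_funTS; exact: emeasurable_funD.
  - move=> a /=; rewrite in_itv /= => /andP[a0 ar].
    rewrite -EFinD lee_fin mulrDr mulr1 -[leRHS]addrA; apply: lerD.
      by apply: failBatch_nincr; rewrite leq_addr.
    apply: IH; rewrite subr_ge0 (ltW ar) /=.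
    by rewrite lerBlDr (le_trans rT) // lerDl.
rewrite ge0_integralD //; last 3 first.
- by move=> a ra; rewrite lee_fin mulr_ge0 ?failBatch_ge0 ?lin0.
- exact: measurable_funTS.
- by move=> a _; rewrite lee_fin exprn_ge0.
under eq_integral do rewrite EFinM.
rewrite ge0_integralZl //; last 2 first.
- exact: measurable_funTS.
- by rewrite lee_fin failBatch_ge0.
rewrite (exp_supersolution lam0 tailE r0) integral_cst //.
rewrite [X in _ + _ * X](exp_law_itvco tailE r0) -!EFinM -EFinD lee_fin lerD2l exprSr.
rewrite ler_wpM2l ?exprn_ge0 // lerB // ler_expR !mulNr lerN2.
by rewrite ler_wpM2l // ltW.
Qed.

End Stability.

(** * Completion with probability tending to one under stability *)

Section StabilityLimit.
Set Implicit Arguments.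
Unset Strict Implicit.
Context {R : realType}.
Local Open Scope ereal_scope.

Variables (PP : probability (@Xi R) R) (nuA : probability R R)
  (nuB : probability nat R) (nuS : probability R R) (lam : R).
Hypothesis lawE : input_law PP nuA nuB nuS.
Hypothesis nuS_neg : nuS `]-oo, 0%R[%classic = 0.
Hypothesis lam0 : (0 < lam)%R.
Hypothesis tailE : forall r : R, (0 <= r)%R -> nuA `[r, +oo[%classic = (expR (- lam * r))%:E.
Hypothesis stable : lam%:E * (\int[nuB]_b b%:R%:E) *
  (\int[nuS]_(s in `[0%R, +oo[) s%:E) < 1.

Let nuA_neg := exp_law_neg tailE.
Let memoryless := exp_law_memoryless tailE.

Local Notation F m := (avgBatch PP nuB (serve m) +oo xpredT).
Local Notation v m := (prServe PP (serve m) +oo xpredT).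
Local Notation z m := (avgServe PP nuS (serve m) +oo xpredT).
Local Notation failBatch := (failBatch PP nuB).
Local Notation failServe := (failServe PP).

Definition failServe_lim (r : R) : R := limn (fun m => failServe m r).
Definition failBatch_lim : R := limn failBatch.

Lemma failServe_cvg r : failServe m r @[m --> \oo] --> failServe_lim r.
Proof.
apply: nonincreasing_is_cvgn; first exact: failServe_nincr.
by exists 0%R => _ [m _ <-]; exact: failServe_ge0.
Qed.

Lemma failBatch_cvg : failBatch m @[m --> \oo] --> failBatch_lim.
Proof.
apply: nonincreasing_is_cvgn; first exact: failBatch_nincr.
by exists 0%R => _ [m _ <-]; exact: failBatch_ge0.
Qed.

Lemma failServe_lim_ge0 r : (0 <= failServe_lim r)%R.
Proof. by apply: limr_ge; [exact: failServe_cvg|near=> m; exact: failServe_ge0]. Unshelve. all: end_near. Qed.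

Lemma failBatch_lim_ge0 : (0 <= failBatch_lim)%R.
Proof. by apply: limr_ge; [exact: failBatch_cvg|near=> m; exact: failBatch_ge0]. Unshelve. all: end_near. Qed.

Lemma failBatch_lim_le m : (failBatch_lim <= failBatch m)%R.
Proof.
apply: nonincreasing_cvgn_ge; first exact: failBatch_nincr.
exact: failBatch_cvg.
Qed.

(** In [failServe_bound] with [T = r], first [j] grows at fixed [m], which removes the geometric
    term because [kap < 1]; only then does [m] grow. *)
Lemma failServe_lim_le r : (0 <= r)%R -> (failServe_lim r <= failBatch_lim * (lam * r))%R.
Proof.
move=> r0; set kap := (1 - expR (- lam * r))%R.
have k0 : (0 <= kap)%R.
  by rewrite /kap subr_ge0 -expR0 ler_expR mulNr oppr_le0 mulr_ge0 // ltW.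
have k1 : (kap < 1)%R by rewrite /kap gtrBl expR_gt0.
have step m : (failServe_lim r <= failBatch m * (lam * r))%R.
  have c1 : failServe (m + j)%N r @[j --> \oo] --> failServe_lim r.
    have := @failServe_cvg r; rewrite -(cvg_shiftn m) => h.
    by under eq_fun do rewrite addnC; exact: h.
  have c2 : (failBatch m * (lam * r) + kap ^+ j)%R @[j --> \oo] --> (failBatch m * (lam * r) + 0)%R.
    apply: cvgD; first exact: cvg_cst.
    by apply: cvg_expr; rewrite ger0_norm.
  rewrite -[leRHS]addr0; apply: (ler_cvg_to c1 c2); near=> j.
  by apply: (failServe_bound lawE nuS_neg lam0 tailE); rewrite r0 lexx.
have c3 : (failBatch m * (lam * r))%R @[m --> \oo] --> (failBatch_lim * (lam * r))%R.
  by apply: cvgMl; exact: failBatch_cvg.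
by apply: (cvgr_to_ge c3); near=> m; exact: step.
Unshelve. all: end_near. Qed.

Lemma avgServe_le1 m : z m <= 1.
Proof.
apply: (@le_trans _ _ (\int[nuS]_s cst 1 s)); last first.
  by rewrite integral_cst // mul1e probability_le1.
apply: ge0_le_integral => //.
- exact: (measurable_prServe PP _ _ (@measurable_serve R m)).
- by move=> s _; exact: prServe_le1.
Qed.

Lemma avgServe_fin m : z m \is a fin_num.
Proof. by rewrite ge0_fin_numE ?avgServe_ge0 // (le_lt_trans (avgServe_le1 m)) ?ltry. Qed.

Definition failAvg m : R := (1 - fine (z m))%R.

Lemma failAvg_ge0 m : (0 <= failAvg m)%R.
Proof. by rewrite -lee_fin /failAvg EFinB fineK ?avgServe_fin // sube_ge0 ?avgServe_le1 ?avgServe_fin. Qed.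

Lemma failAvg_E m : (failAvg m)%:E = \int[nuS]_s (failServe m s)%:E.
Proof.
have mv := measurable_prServe PP +oo xpredT (@measurable_serve R m).
have : \int[nuS]_s ((failServe m s)%:E + v m s) = 1.
  under eq_integral do rewrite failServe_E subeK ?prServe_fin //.
  by rewrite integral_cst // mul1e; exact: probability_setT.
rewrite ge0_integralD //; last 2 first.
- by move=> s _; rewrite lee_fin failServe_ge0.
- exact: measurable_failServe.
move=> h; rewrite /failAvg EFinB fineK ?avgServe_fin // -h addeK //; exact: avgServe_fin.
Qed.

Lemma measurable_failServe_lim : measurable_fun setT (fun s => (failServe_lim s)%:E).
Proof.
apply: (emeasurable_fun_cvg (fun m s => (failServe m s)%:E)).
- by move=> m; exact: measurable_failServe.
- by move=> s _; apply: cvg_EFin; [near=> m|exact: failServe_cvg].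
Unshelve. all: end_near. Qed.

Lemma failAvg_cvgE : (failAvg m)%:E @[m --> \oo] --> \int[nuS]_s (failServe_lim s)%:E.
Proof.
under eq_fun do rewrite failAvg_E.
apply: (@dominated_cvg _ _ _ nuS setT _ (fun m s => (failServe m s)%:E)
  (fun s => (failServe_lim s)%:E) (cst 1)) => //.
- by move=> m; exact: measurable_failServe.
- by move=> s _; apply: cvg_EFin; [near=> m|exact: failServe_cvg].
- exact: finite_measure_integrable_cst.
- by move=> m s _; rewrite gee0_abs lee_fin ?failServe_ge0 ?failServe_le1.
Unshelve. all: end_near. Qed.

Lemma failServe_lim_integral :
  \int[nuS]_s (failServe_lim s)%:E <= (failBatch_lim * lam)%:E * \int[nuS]_(s in `[0%R, +oo[) s%:E.
Proof.
have mE : measurable_fun setT (fun s : R => s%:E) by exact/measurable_EFinP.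
rewrite ge0_integral_nonneg_support //; last 2 first.
- exact: measurable_failServe_lim.
- by move=> s; rewrite lee_fin failServe_lim_ge0.
rewrite -ge0_integralZl //; last 2 first.
- by move=> s; rewrite /= in_itv /= andbT lee_fin.
- by rewrite lee_fin mulr_ge0 ?failBatch_lim_ge0 // ltW.
apply: ge0_le_integral => //.
- by move=> s _; rewrite lee_fin failServe_lim_ge0.
- by apply: measurable_funTS; exact: measurable_failServe_lim.
- by apply: measurable_funTS; exact: emeasurable_funM.
- move=> s; rewrite /= in_itv /= andbT => s0.
  by rewrite -EFinM lee_fin -mulrA failServe_lim_le.
Qed.

(** Each customer of the batch starts from a regenerated input, and [+oo - 1 = +oo] keeps the height
    unconstrained. *)
Lemma prBatch_full m b :
  prBatch PP (serve m) b +oo xpredT = ((1 - failAvg m) ^+ b)%:E.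
Proof.
elim: b => [|b IH]; first by rewrite prBatch0 leey /= expr0.
rewrite (prBatch_pred lawE) // addye // IH exprSr EFinM; congr (_ * _).
by rewrite /failAvg subKr fineK // avgServe_fin.
Qed.

Lemma failAvg_le1 m : (failAvg m <= 1)%R.
Proof. by rewrite /failAvg gerBl fine_ge0 // avgServe_ge0. Qed.

Lemma bernoulli_ineq (x : R) b : (0 <= x <= 1)%R -> (1 <= (1 - x) ^+ b + b%:R * x)%R.
Proof.
move=> /andP[x0 x1]; elim: b => [|b IH]; first by rewrite expr0 mul0r addr0.
have e1 : ((1 - x) ^+ b <= 1)%R by rewrite exprn_ile1 // ?subr_ge0 // gerBl.
have e0 : (0 <= (1 - x) ^+ b)%R by rewrite exprn_ge0 // subr_ge0.
rewrite exprSr -natr1; nra.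
Qed.

(** Bernoulli's inequality plays the role of a union bound over the customers of a batch, averaged
    over its size. *)
Lemma failBatch_le m : (failBatch m)%:E <= (\int[nuB]_b b%:R%:E) * (failAvg m)%:E.
Proof.
rewrite failBatch_E leeBlDr ?avgBatch_fin // -ge0_integralZr //; last by rewrite lee_fin failAvg_ge0.
rewrite addeC -ge0_integralD //; last first.
  by move=> b _; rewrite -EFinM lee_fin mulr_ge0 ?failAvg_ge0.
have -> : 1 = \int[nuB]_b cst 1 b.
  by apply/esym; rewrite integral_cst // mul1e; exact: probability_setT.
apply: ge0_le_integral => // b _; rewrite prBatch_full -EFinM -EFinD lee_fin.
by apply: bernoulli_ineq; rewrite failAvg_ge0 failAvg_le1.
Qed.

(* The limits satisfy [failBatch_lim <= mu * I <= failBatch_lim * (lam * mu * ES)]. *)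
Lemma integral_failServe_lim : \int[nuS]_s (failServe_lim s)%:E = 0.
Proof.
set I := \int[nuS]_s _.
have I0 : 0 <= I by apply: integral_ge0 => s _; rewrite lee_fin failServe_lim_ge0.
have := failServe_lim_integral; rewrite -/I.
set ES := \int[nuS]_(s in _) _ => le_I.
have ES0 : 0 <= ES by apply: integral_ge0 => s; rewrite /= in_itv /= andbT lee_fin.
move: stable; rewrite -/ES; set mu := \int[nuB]_b _ => rho1.
have mu0 : 0 <= mu by apply: integral_ge0 => b _; rewrite lee_fin.
apply/eqP; rewrite eq_le I0 andbT.
(* Stability forces [mu] to be finite only when [ES > 0], since [+oo * 0 = 0]; the case [ES = 0] is
   settled directly. *)
have [ESE|ESn0] := eqVneq ES 0; first by rewrite (le_trans le_I) // ESE mule0.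
have ESp : 0 < ES by rewrite lt0e ESn0.
have muy : mu \is a fin_num.
  rewrite ge0_fin_numE // ltNge; apply/negP; rewrite leye_eq => /eqP muE.
  by move: rho1; rewrite muE gt0_muley ?lte_fin // gt0_mulye.
have le_d : (failBatch_lim)%:E <= mu * I.
  have c : mu * (failAvg m)%:E @[m --> \oo] --> mu * I.
    by apply: cvgeZl => //; exact: failAvg_cvgE.
  apply: (cvge_to_ge c); near=> m.
  by apply: le_trans (failBatch_le m); rewrite lee_fin failBatch_lim_le.
have [d0|dn0] := eqVneq failBatch_lim 0%R; first by rewrite (le_trans le_I) // d0 mul0r mul0e.
have dp : (0 < failBatch_lim)%R by rewrite lt_def dn0 failBatch_lim_ge0.
have : (failBatch_lim)%:E <= failBatch_lim%:E * (lam%:E * mu * ES).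
  apply: (le_trans le_d); apply: (le_trans (lee_wpmul2l mu0 le_I)).
  by rewrite EFinM !muleA [mu * _]muleC -!muleA [mu * (_ * _)]muleCA.
rewrite leNgt => /negP[]; rewrite -[ltRHS]mule1 lte_pmul2l //.
Unshelve. all: end_near. Qed.

Lemma failAvg_cvg0 : failAvg m @[m --> \oo] --> 0%R.
Proof.
have := failAvg_cvgE; rewrite integral_failServe_lim => /fine_cvgP[_].
exact.
Qed.

Lemma prBatch_cvg1 b : prBatch PP (serve m) b +oo xpredT @[m --> \oo] --> 1.
Proof.
under eq_fun do rewrite prBatch_full.
have h : (1 - failAvg m)%R @[m --> \oo] --> (1 - 0 : R)%R.
  by apply: cvgB; [exact: cvg_cst|exact: failAvg_cvg0].
have hb : ((1 - failAvg m) ^+ b)%R @[m --> \oo] --> ((1 - 0) ^+ b : R)%R.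
  elim: b => [|b IH].
    by under eq_fun do rewrite expr0; exact: cvg_cst.
  by under eq_fun do rewrite exprS; rewrite exprS; exact: cvgM.
rewrite subr0 expr1n in hb.
by apply: cvg_EFin; [near=> m|exact: hb].
Unshelve. all: end_near. Qed.

Lemma avgBatch_cvg1 : F m @[m --> \oo] --> 1.
Proof.
have -> : 1 = \int[nuB]_b cst 1 b.
  by apply/esym; rewrite integral_cst // mul1e; exact: probability_setT.
apply: (@dominated_cvg _ _ _ nuB setT _
  (fun m b => prBatch PP (serve m) b +oo xpredT) (cst 1) (cst 1)) => //.
- by move=> b _; exact: prBatch_cvg1.
- exact: finite_measure_integrable_cst.
- move=> m b _; rewrite gee0_abs ?prBatch_ge0 //; apply: probability_le1.
  exact/measurable_good_set/measurable_batch1/measurable_serve.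
Qed.

End StabilityLimit.

(** * Measurability of the sample-path functionals *)

Section PathMeasurability.
Set Implicit Arguments.
Unset Strict Implicit.
Context {R : realType} {d : measure_display} {T : measurableType d}.
Variables (A : nat -> T -> R) (B : nat -> T -> nat) (S : nat -> T -> R).
Hypothesis mA : forall i, measurable_fun setT (A i).
Hypothesis mB : forall i, measurable_fun setT (B i).
Hypothesis mS : forall i, measurable_fun setT (S i).

Local Notation "u ^~~ t" := (fun j => u j t) (at level 2).

(** The default beyond the bottom makes every coordinate total, so a stack of random size is
    described by its size and a sequence of coordinates. *)
Definition entry (s : qstate R) (i : nat) : nat * R := nth (0%N, 0) (q_stack s) i.

(* [qstate] carries no sigma-algebra: measurability is meant coordinatewise. *)
Definition measurable_state (st : T -> qstate R) : Prop :=
  [/\ measurable_fun setT (fun t => q_time (st t)),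
      measurable_fun setT (fun t => size (q_stack (st t))),
      measurable_fun setT (fun t => q_next_batch (st t)),
      measurable_fun setT (fun t => q_next_id (st t)) &
      forall i, measurable_fun setT (fun t => (entry (st t) i).1) /\
                measurable_fun setT (fun t => (entry (st t) i).2)].

Lemma measurable_nat2 {d'} {U : measurableType d'} (g : nat -> nat -> U) (a b : T -> nat) :
  measurable_fun setT a -> measurable_fun setT b ->
  measurable_fun setT (fun t => g (a t) (b t)).
Proof.
move=> ma mb; apply: (@measurable_natcase _ _ _ _ a (fun n t => g n (b t)) ma) => n.
exact: (@measurableT_comp _ _ _ _ _ _ (g n)).
Qed.

Lemma nth_new_customers (s : nat -> R) c b i : (i < b)%N ->
  nth (0%N, 0) (new_customers s c b) i = ((c + (b - i.+1))%N, s (c + (b - i.+1))%N).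
Proof.
move=> ib; rewrite /new_customers nth_rev size_map size_iota //.
have lt : (b - i.+1 < b)%N by lia.
by rewrite (nth_map 0%N) ?size_iota // nth_iota // add0n.
Qed.

Lemma size_new_customers (s : nat -> R) c b : size (new_customers s c b) = b.
Proof. by rewrite /new_customers size_rev size_map size_iota. Qed.

Definition departs (a : nat -> R) (st : qstate R) : bool :=
  q_time st + (entry st 0).2 <= arrival_time a (q_next_batch st).

(** Tests on coordinates replace the pattern matching, so that each projection can be pushed into
    the branches and treated by [measurable_fun_ifT]. *)
Lemma stepE a b s (st : qstate R) :
  step a b s st =
  if size (q_stack st) == 0%N then st
  else if departs a st then
    QState (q_time st + (entry st 0).2) (behead (q_stack st)) (q_next_batch st) (q_next_id st)
  else
    QState (arrival_time a (q_next_batch st))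
      (new_customers s (q_next_id st) (b (q_next_batch st)) ++
        ((entry st 0).1, (entry st 0).2 - (arrival_time a (q_next_batch st) - q_time st))
        :: behead (q_stack st))
      (q_next_batch st).+1 (q_next_id st + b (q_next_batch st))%N.
Proof. by rewrite /step /departs /entry; case: (q_stack st) => [//|[id r] rest] /=. Qed.

Lemma measurable_arrival_time (j : T -> nat) : measurable_fun setT j ->
  measurable_fun setT (fun t => arrival_time A^~~ t (j t)).
Proof.
move=> mj; apply: (@measurable_natcase _ _ _ _ j (fun j t => arrival_time A^~~ t j)) => // n.
exact: measurable_sum.
Qed.

Section Step.
Variable st : T -> qstate R.
Hypothesis mst : measurable_state st.

Lemma measurable_departs : measurable_fun setT (fun t => departs A^~~ t (st t)).
Proof.
case: mst => mt _ mb _ me.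
apply: measurable_fun_ler; last exact: measurable_arrival_time.
by apply: measurable_funD => //; case: (me 0%N).
Qed.

Lemma measurable_is_empty : measurable_fun setT (fun t => size (q_stack (st t)) == 0%N).
Proof.
case: mst => _ ms _ _ _.
exact: (@measurableT_comp _ _ _ _ _ _ (fun n : nat => n == 0%N)).
Qed.

Lemma measurable_step : measurable_state (fun t => step A^~~ t B^~~ t S^~~ t (st t)).
Proof.
case: (mst) => mt ms mb mi me.
have md := measurable_departs.
have m0 := measurable_is_empty.
have [me1 me2] := me 0%N.
have mar := measurable_arrival_time mb.
have mBb : measurable_fun setT (fun t => B (q_next_batch (st t)) t).
  exact: (@measurable_natcase _ _ _ _ (fun t => q_next_batch (st t)) B).
split.
- under eq_fun do rewrite stepE (fun_if (@q_time R)) (fun_if (@q_time R)).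
  by do !apply: measurable_fun_ifT => //; exact: measurable_funD.
- under eq_fun do rewrite stepE (fun_if (fun s : qstate R => size (q_stack s)))
     (fun_if (fun s : qstate R => size (q_stack s))).
  do !apply: measurable_fun_ifT => //=.
    under eq_fun do rewrite size_behead.
    exact: (@measurableT_comp _ _ _ _ _ _ predn).
  under eq_fun do rewrite size_cat size_new_customers /= size_behead.
  apply: measurable_fun_addn => //.
  exact: (@measurableT_comp _ _ _ _ _ _ (fun n => n.-1.+1)).
- under eq_fun do rewrite stepE (fun_if (@q_next_batch R)) (fun_if (@q_next_batch R)).
  by do !apply: measurable_fun_ifT => //; exact: measurable_natS.
- under eq_fun do rewrite stepE (fun_if (@q_next_id R)) (fun_if (@q_next_id R)).
  by do !apply: measurable_fun_ifT => //; exact: measurable_fun_addn.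
move=> i.
(* After a preemption, position [i] holds a new customer, the preempted one at [i = b], or the old
   entry [i - b]: the old head is replaced in place, so there is no further offset. *)
have nthE t : nth (0%N, 0) (new_customers S^~~ t (q_next_id (st t)) (B (q_next_batch (st t)) t) ++
        ((entry (st t) 0).1, (entry (st t) 0).2 -
           (arrival_time A^~~ t (q_next_batch (st t)) - q_time (st t)))
        :: behead (q_stack (st t))) i =
   let b := B (q_next_batch (st t)) t in
   let c := (q_next_id (st t) + (b - i.+1))%N in
   if (i < b)%N then (c, S c t) else
   if i == b then ((entry (st t) 0).1, (entry (st t) 0).2 -
           (arrival_time A^~~ t (q_next_batch (st t)) - q_time (st t)))
   else entry (st t) (i - b).
  rewrite /= nth_cat size_new_customers; case: ifPn => [ib|]; first by rewrite nth_new_customers.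
  rewrite -leqNgt => bi; case: eqP => [->|/eqP ib]; first by rewrite subnn.
  have : (0 < i - (B (q_next_batch (st t)) t))%N by rewrite subn_gt0 ltn_neqAle eq_sym ib.
  by case: (i - _)%N => // k _; rewrite /= nth_behead.
have mib : measurable_fun setT (fun t => (i < B (q_next_batch (st t)) t)%N).
  exact: (@measurableT_comp _ _ _ _ _ _ (fun n => (i < n)%N)).
have mieb : measurable_fun setT (fun t => i == B (q_next_batch (st t)) t).
  exact: (@measurableT_comp _ _ _ _ _ _ (fun n => i == n)).
have mc : measurable_fun setT (fun t => (q_next_id (st t) + (B (q_next_batch (st t)) t - i.+1))%N).
  exact: (measurable_nat2 (fun a b : nat => a + (b - i.+1))%N).
have [me1' me2'] := me i.
have [me1'' me2''] := me i.+1.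
split.
- under eq_fun do rewrite /entry stepE (fun_if (fun s : qstate R => (nth (0%N, 0) (q_stack s) i).1))
     (fun_if (fun s : qstate R => (nth (0%N, 0) (q_stack s) i).1)).
  do 2!apply: measurable_fun_ifT => //=.
    by under eq_fun do rewrite nth_behead.
  under eq_fun do rewrite nthE /= (fun_if fst) (fun_if fst) /=.
  do 2!apply: measurable_fun_ifT => //=.
  apply: (@measurable_natcase _ _ _ _ (fun t => B (q_next_batch (st t)) t)
    (fun b t => (entry (st t) (i - b)).1)) => // n.
  by case: (me (i - n)%N).
- under eq_fun do rewrite /entry stepE (fun_if (fun s : qstate R => (nth (0%N, 0) (q_stack s) i).2))
     (fun_if (fun s : qstate R => (nth (0%N, 0) (q_stack s) i).2)).
  do 2!apply: measurable_fun_ifT => //=.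
    by under eq_fun do rewrite nth_behead.
  under eq_fun do rewrite nthE /= (fun_if snd) (fun_if snd) /=.
  apply: measurable_fun_ifT => //=; first exact: (@measurable_natcase _ _ _ _ _ S mc).
  apply: measurable_fun_ifT => //=; first by apply: measurable_funB => //; exact: measurable_funB.
  apply: (@measurable_natcase _ _ _ _ (fun t => B (q_next_batch (st t)) t)
    (fun b t => (entry (st t) (i - b)).2)) => // n.
  by case: (me (i - n)%N).
Qed.

End Step.

Lemma measurable_init k : measurable_state (fun t => init_state S^~~ t k).
Proof.
split => //=.
  by under eq_fun do rewrite size_new_customers; exact: measurable_cst.
move=> i; rewrite /entry /=; case: (ltnP i k) => ik.
  split.
    by under eq_fun do rewrite nth_new_customers //=; exact: measurable_cst.
  by under eq_fun do rewrite nth_new_customers //=; exact: mS.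
split.
  by under eq_fun do rewrite nth_default ?size_new_customers //=; exact: measurable_cst.
by under eq_fun do rewrite nth_default ?size_new_customers //=; exact: measurable_cst.
Qed.

Lemma measurable_traj k n : measurable_state (fun t => traj A^~~ t B^~~ t S^~~ t k n).
Proof.
elim: n => [|n IH]; first exact: measurable_init.
exact: (measurable_step IH).
Qed.

Lemma measurable_sup_nat (f : nat -> T -> nat) : (forall n, measurable_fun setT (f n)) ->
  measurable_fun setT (fun t => ereal_sup (range (fun n => ((f n t)%:R : R)%:E))).
Proof.
move=> mf.
have mf' n : measurable_fun setT (fun t => ((f n t)%:R : R)%:E).
  exact: (@measurableT_comp _ _ _ _ _ _ (fun n : nat => (n%:R : R)%:E)).
have := measurable_fun_esups mf' 0%N.
congr (measurable_fun _ _); apply/funext => t; rewrite /esups /sdrop; congr ereal_sup.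
by apply/seteqP; split=> _ [n _ <-]; exists n.
Qed.

Lemma measurable_busy_max (k : T -> nat) : measurable_fun setT k ->
  measurable_fun setT (fun t => busy_max A^~~ t B^~~ t S^~~ t (k t)).
Proof.
move=> mk; apply: (@measurable_natcase _ _ _ _ k
  (fun k t => busy_max A^~~ t B^~~ t S^~~ t k)) => // n.
by apply: measurable_sup_nat => m; case: (measurable_traj n m).
Qed.

Lemma measurable_arrivals_count k m :
  measurable_fun setT (fun t => arrivals_during_cust0 A^~~ t B^~~ t S^~~ t k m).
Proof.
rewrite /arrivals_during_cust0; elim: (iota 0 m) => [|i l IH] //=.
apply: measurable_fun_addn => //.
have mst := measurable_traj k i.
have E t : arrival_during A^~~ t (cust0 k) (traj A^~~ t B^~~ t S^~~ t k i) =
   [&& size (q_stack (traj A^~~ t B^~~ t S^~~ t k i)) != 0%N,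
       (entry (traj A^~~ t B^~~ t S^~~ t k i) 0).1 == cust0 k &
       ~~ departs A^~~ t (traj A^~~ t B^~~ t S^~~ t k i)].
  by rewrite /arrival_during /departs /entry; case: (q_stack _) => [//|[id r] rest].
apply: (@measurableT_comp _ _ _ _ _ _ nat_of_bool) => //.
under eq_fun do rewrite E.
apply: measurable_and; first by apply: measurable_neg; exact: measurable_is_empty.
apply: measurable_and; last by apply: measurable_neg; exact: measurable_departs.
case: mst => _ _ _ _ /(_ 0%N)[m1 _].
exact: (@measurableT_comp _ _ _ _ _ _ (fun n : nat => n == cust0 k)).
Qed.

Lemma measurable_serv0_arrivals (k : T -> nat) : measurable_fun setT k ->
  measurable_fun setT (fun t => serv0_arrivals A^~~ t B^~~ t S^~~ t (k t)).
Proof.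
move=> mk; apply: (@measurable_natcase _ _ _ _ k
  (fun k t => serv0_arrivals A^~~ t B^~~ t S^~~ t k)) => // n.
by apply: measurable_sup_nat => m; exact: measurable_arrivals_count.
Qed.

End PathMeasurability.

(** * The law of the maximum *)

Section Laws.
Set Implicit Arguments.
Unset Strict Implicit.
Context {R : realType}.
Local Open Scope ereal_scope.

Definition law {d d'} {T : measurableType d} {T' : measurableType d'}
    (P : probability T R) (X : T -> T') (mX : measurable_fun setT X) : probability T' R :=
  distribution P (mfun_Sub (mem_set mX)).

Lemma law_val {d d'} {T : measurableType d} {T' : measurableType d'}
    (P : probability T R) (X : T -> T') (mX : measurable_fun setT X) V :
  law P mX V = P (X @^-1` V).
Proof. by []. Qed.

Lemma integral_law {d d'} {T : measurableType d} {T' : measurableType d'}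
    (P : probability T R) (X : T -> T') (mX : measurable_fun setT X) D (f : T' -> \bar R) :
  measurable D -> measurable_fun D f -> (forall y, D y -> 0 <= f y) ->
  \int[law P mX]_(y in D) f y = \int[P]_(x in X @^-1` D) f (X x).
Proof.
move=> mD mf f0; rewrite -(@ge0_integral_pushforward _ _ _ _ _ _ mX P D f) //.
by move=> y; rewrite inE; exact: f0.
Qed.

(** Intersecting with [O m] loses at most [1 - P (O m)]. With [O m] the completion within fuel [m],
    this carries truncated identities over to the actual busy period. *)
Lemma cvg_prob_setI {d} {T : measurableType d} (P : probability T R) (G : set T)
    (O : nat -> set T) : measurable G -> (forall m, measurable (O m)) ->
  P (O m) @[m --> \oo] --> 1 -> P (G `&` O m) @[m --> \oo] --> P G.
Proof.
move=> mG mO PO.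
have c : P G - (1 - P (O m)) @[m --> \oo] --> P G - (1 - 1).
  apply: cvgeB; [|exact: cvg_cst|].
    by rewrite subee // fin_num_adde_defl.
  by apply: cvgeB; [|exact: cvg_cst|exact: PO].
rewrite subee // sube0 in c.
apply: (@squeeze_cvge _ _ _ _ (fun m => P G - (1 - P (O m))) _ (fun=> P G));
  [|exact: c|exact: cvg_cst].
near=> m.
apply/andP; split; last by apply: le_measure; rewrite ?inE //; exact: measurableI.
rewrite -probability_setC // leeBlDr ?fin_num_measure //; last exact: measurableC.
apply: (@le_trans _ _ (P ((G `&` O m) `|` ~` O m))).
  apply: le_measure; rewrite ?inE //.
    by apply: measurableU; [exact: measurableI|exact: measurableC].
  by move=> t Gt; case: (pselect (O m t)) => h; [left|right].
by apply: measureU2; [exact: measurableI|exact: measurableC].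
Unshelve. all: end_near. Qed.

Lemma measure_nat_ext (m1 m2 : {measure set nat -> \bar R}) :
  (forall j, m1 [set j] = m2 [set j]) -> forall V, m1 V = m2 V.
Proof.
move=> h V.
have VE : V = \bigcup_(j in V) [set j].
  by apply/seteqP; split=> [j Vj|j [i Vi /= ->]] //; exists j.
by rewrite VE !measure_bigcup //; first (by apply: eq_eseriesr => j _; exact: h);
  move=> i j _ _ [x [/= -> ->]].
Qed.

(** Finite levels suffice: total mass 1 turns them into the masses of the upper rays, which contain
    [+oo]. *)
Lemma ereal_measure_ext (m1 m2 : {measure set (\bar R) -> \bar R}) :
  m1 setT = 1 -> m2 setT = 1 ->
  (forall x : R, m1 [set y | y <= x%:E] = m2 [set y | y <= x%:E]) ->
  forall V, measurable V -> m1 V = m2 V.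
Proof.
move=> t1 t2 h V mV.
(* [setT] is added to the rays because they do not cover [-oo]. *)
pose G2 : set (set (\bar R)) := [set U | U = setT \/ exists r : R, U = `]r%:E, +oo[%classic].
have mle (x : R) : measurable ([set y | y <= x%:E] : set (\bar R)).
  rewrite (_ : [set _ | _] = `]-oo, x%:E]%classic); first exact: emeasurable_itv.
  by apply/seteqP; split=> y /=; rewrite in_itv.
have gtE (r : R) : `]r%:E, +oo[%classic = ~` [set y | y <= r%:E] :> set (\bar R).
  apply/seteqP; split=> y /=; rewrite in_itv /= andbT => hy.
    by apply/negP; rewrite -ltNge.
  by rewrite ltNge; exact/negP.
have compl (m : {measure set (\bar R) -> \bar R}) (r : R) : m setT = 1 ->
    m `]r%:E, +oo[%classic = 1 - m [set y | y <= r%:E].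
  move=> mT; have fin : m [set y | y <= r%:E] \is a fin_num.
    rewrite ge0_fin_numE // (@le_lt_trans _ _ 1) ?ltry // -mT.
    by apply: le_measure; rewrite ?inE.
  rewrite -mT -(setUv [set y | y <= r%:E]) measureU //; last 2 first.
  - by apply: measurableC; exact: mle.
  - exact: setICr.
  by rewrite gtE addeAC subee // add0e.
apply: (@g_sigma_algebra_measure_unique _ R (\bar R) G2 _ (fun=> setT) _ _ m1 m2).
- move=> _ [->|[r ->]]; [exact: measurableT|exact: emeasurable_itv].
- by move=> _; left.
- by rewrite bigcup_const.
- move=> U W [->|[r ->]] [->|[s ->]]; rewrite ?setIT ?setTI; [by left|by right; exists s|by right; exists r|].
  right; exists (Num.max r s).
  apply/seteqP; split=> y /=; rewrite !in_itv /= !andbT EFin_max gt_max; last by move/andP.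
  by case=> -> ->.
- by move=> U [->|[r ->]]; [rewrite t1 t2|rewrite !compl // h].
- by move=> _; rewrite t1 ltry.
- have sub : <<s @ErealGenOInfty.G R >> `<=` <<s G2 >>.
    by apply: sub_smallest2r => // U [r ->]; right; exists r.
  apply: sub; rewrite -[X in X V]/((@ErealGenOInfty.G R).-sigma.-measurable).
  by rewrite -ErealGenOInfty.measurableE; exact: mV.
Qed.

End Laws.

(** * Joint law of the maximum and of the arrivals during the first service *)

Section BusyPeriod.
Set Implicit Arguments.
Unset Strict Implicit.
Context {R : realType} {d : measure_display} {Omega : measurableType d}.
Local Open Scope ereal_scope.
Variables (P : probability Omega R) (lam : R)
  (A : nat -> Omega -> R) (B : nat -> Omega -> nat) (S : nat -> Omega -> R).
Hypothesis lam0 : (0 < lam)%R.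
Hypothesis mA : forall i, measurable_fun setT (A i).
Hypothesis lawA : forall i (V : set R), measurable V ->
  P (A i @^-1` V) = exponential_prob lam V.
Hypothesis mB1 : forall i j, measurable (B i @^-1` [set j]).
Hypothesis lawB : forall i j, P (B i @^-1` [set j]) = P (B 0%N @^-1` [set j]).
Hypothesis mS : forall i, measurable_fun setT (S i).
Hypothesis lawS : forall i (V : set R), measurable V ->
  P (S i @^-1` V) = P (S 0%N @^-1` V).
Hypothesis S_ge0 : P [set w | 0 <= S 0%N w]%R = 1%E.
Hypothesis indep : inputs_independent P A B S.
Hypothesis stable :
  lam%:E * (\int[P]_w ((B 0%N w)%:R)%:E) * (\int[P]_w (S 0%N w)%:E) < 1.

Lemma measurable_fun_B i : measurable_fun setT (B i).
Proof.
move=> _ V _; rewrite setTI.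
rewrite (_ : B i @^-1` V = \bigcup_(j in V) B i @^-1` [set j]).
  by apply: bigcup_measurable => j _; exact: mB1.
by apply/seteqP; split=> [w /= Vw|w [j Vj /= ->]] //; exists (B i w).
Qed.
Let mB := measurable_fun_B.

(** The gaps start at index 1, as in [arrival_time]. The size of the first batch is kept in front as
    an independent coordinate, which [busy_input] strips off. *)
Definition input_path (w : Omega) : @Xi R := (fun i => A i.+1 w, fun i => B i w, fun i => S i w).

Lemma measurable_input_path : measurable_fun setT input_path.
Proof. by apply: measurable_to_Xi => i /=. Qed.

Let PP := law P measurable_input_path.
Let nuA := law P (mA 0).
Let nuB := law P (mB 0).
Let nuS := law P (mS 0).

Lemma law_batch_size i V : P (B i @^-1` V) = P (B 0%N @^-1` V).
Proof.
exact: (@measure_nat_ext _ (law P (mB i)) (law P (mB 0)) (lawB i) V).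
Qed.

Lemma input_path_law : input_law PP nuA nuB nuS.
Proof.
move=> n a b s ma ms.
(* Independence is used for [n.+1] indices: the gaps occupy [1..n], the sizes and services [0..n-1],
   and the remaining slots receive [setT]. *)
pose a' i := if i is j.+1 then if (j < n)%N then a j else setT else setT.
pose b' i := if (i < n)%N then b i else setT.
pose s' i := if (i < n)%N then s i else setT.
have ma' i : measurable (a' i) by rewrite /a'; case: i => // i; case: ifP.
have ms' i : measurable (s' i) by rewrite /s'; case: ifP.
rewrite law_val (_ : input_path @^-1` _ =
  \bigcap_(i in `I_n.+1) (A i @^-1` a' i `&` B i @^-1` b' i `&` S i @^-1` s' i)); last first.
  apply/seteqP; split=> w /= h i /=.
    move=> _; rewrite /a' /b' /s'; split; last by case: ifP => // ilt; have [] := h i ilt.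
    split; last by case: ifP => // ilt; have [] := h i ilt.
    by case: i => //= i; case: ifP => // ilt; have [] := h i ilt.
  move=> ilt; have [[h1 h2] h3] := h i (ltnW ilt).
  have [[h4 _] _] := h i.+1 ilt.
  by move: h2 h3 h4; rewrite /= /a' /b' /s' ilt.
rewrite indep //; congr EFin.
rewrite !big_split /=; congr (_ * _ * _)%R.
- rewrite big_ord_recl /= probability_setT /= mul1r; apply: eq_bigr => i _.
  by rewrite /a' /= /bump /= add1n ltn_ord lawA // law_val lawA.
- rewrite big_ord_recr /= {2}/b' ltnn preimage_setT probability_setT mulr1.
  by apply: eq_bigr => i _; rewrite /b' ltn_ord law_batch_size.
- rewrite big_ord_recr /= {2}/s' ltnn preimage_setT probability_setT mulr1.
  by apply: eq_bigr => i _; rewrite /s' ltn_ord lawS.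
Qed.

Lemma service_nonneg : nuS `]-oo, 0%R[%classic = 0.
Proof.
rewrite -setCitvr probability_setC // law_val.
rewrite (_ : S 0%N @^-1` _ = [set w | 0 <= S 0%N w]%R) ?S_ge0 ?subee //.
by apply/seteqP; split=> w /=; rewrite in_itv /= andbT.
Qed.

Lemma gap_tail (r : R) : (0 <= r)%R -> nuA `[r, +oo[%classic = (expR (- lam * r))%:E.
Proof.
move=> r0.
have E V : measurable V -> nuA V = exponential_prob lam V by move=> mV; rewrite law_val lawA.
have neg0 : nuA `]-oo, 0%R[%classic = 0.
  rewrite E // /exponential_prob; apply: integral0_eq => x.
  by rewrite /= in_itv /= => x0; rewrite lt0_exponential_pdf.
have pt0 : nuA [set r] = 0 by rewrite E // /exponential_prob integral_set1.
have cc : nuA `[0%R, r]%classic = (1 - expR (- lam * r))%:E.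
  move: r0; rewrite le_eqVlt => /predU1P[<-|r0].
    rewrite mulr0 expR0 subrr set_itv1 E // /exponential_prob integral_set1 //.
  by rewrite E // exponential_prob_itv0c // EFinB.
have U1 : `]-oo, r]%classic = `]-oo, 0%R[%classic `|` `[0%R, r]%classic :> set R.
  apply/seteqP; split=> x /=; rewrite !in_itv /=.
    by move=> ->; rewrite andbT; case: (leP 0%R x) => h; [right|left].
  by case=> [x0|/andP[]//]; exact: le_trans (ltW x0) r0.
have c1 : nuA `]-oo, r]%classic = (1 - expR (- lam * r))%:E.
  rewrite U1 measureU //; last first.
    apply/seteqP; split=> x //=; rewrite !in_itv /= => -[x0 /andP[x1 _]].
    by move: (le_lt_trans x1 x0); rewrite ltxx.
  by rewrite [X in X + _](neg0 : nuA _ = _) add0e; exact: cc.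
have U2 : `[r, +oo[%classic = [set r] `|` `]r, +oo[%classic :> set R.
  by rewrite setU1itv // bnd_simp.
rewrite U2 measureU //; last first.
  by apply/seteqP; split=> x //= [->]; rewrite in_itv /= ltxx.
have c2 : nuA `]r, +oo[%classic = (expR (- lam * r))%:E.
  by rewrite -setCitvl probability_setC // c1 -EFinB subKr.
by rewrite [X in (X + _)%R](pt0 : nuA _ = _) add0r; exact: c2.
Qed.

(** [S 0] is almost surely nonnegative, so its mean can be taken over the half line on which
    [failServe_lim_le] holds. *)
Lemma law_stable : lam%:E * (\int[nuB]_b b%:R%:E) *
  (\int[nuS]_(s in `[0%R, +oo[) s%:E) < 1.
Proof.
have mid : measurable_fun setT (fun s : R => s%:E) by exact/measurable_EFinP.
have EB : \int[nuB]_b b%:R%:E = \int[P]_w ((B 0%N w)%:R)%:E :> \bar R.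
  by rewrite integral_law // preimage_setT.
have mS0 : measurable (S 0%N @^-1` `[0%R, +oo[).
  by rewrite -[X in measurable X]setTI; exact: mS.
have mES : measurable_fun setT (fun w => (S 0%N w)%:E).
  exact: (measurableT_comp mid (mS 0%N)).
have ES : \int[nuS]_(s in `[0%R, +oo[) s%:E = \int[P]_w (S 0%N w)%:E.
  rewrite integral_law //; last by move=> s; rewrite /= in_itv /= andbT lee_fin.
  rewrite integral_mkcond; apply: ae_eq_integral => //.
  - by apply/(measurable_restrictT _ mS0); exact: measurable_funTS mES.
  have PN : P (~` (S 0%N @^-1` `[0%R, +oo[)) = 0.
    rewrite probability_setC // (_ : S 0%N @^-1` _ = [set w | 0 <= S 0%N w]%R) ?S_ge0 ?subee //.
    by apply/seteqP; split=> w /=; rewrite in_itv /= andbT.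
  exists (~` (S 0%N @^-1` `[0%R, +oo[)); split => //; first exact: measurableC.
  move=> w /= h h'; apply: h => _; rewrite /patch mem_set //.
by rewrite EB ES.
Qed.

Let busy_input (w : Omega) : @Xi R := tailB (input_path w).

Lemma busy_sound m k w (rho := batch (serve m) k (busy_input w)) : ok rho ->
  busy_max (A ^~ w) (B ^~ w) (S ^~ w) k = (height rho)%:R%:E /\
  ((0 < k)%N -> serv0_arrivals (A ^~ w) (B ^~ w) (S ^~ w) k = (arrivals rho)%:R%:E).
Proof.
have E : ((residual (A ^~ w) (B ^~ w) (S ^~ w) (init_state (S ^~ w) k)).1, S ^~ w) = busy_input w.
  rewrite /residual /busy_input /input_path /tailB /stail /=; congr (_, _, _).
  apply/funext => -[|i] /=; last by rewrite add1n.
  by rewrite /arrival_time big_nat1 subr0.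
by have := @busy_period_sound R (A ^~ w) (B ^~ w) (S ^~ w) m k; cbv zeta; rewrite E; apply.
Qed.

(** The size of the first batch is independent of [busy_input], so it can be integrated out first.
    The choice of [K] and [o] covers a random first batch, a fixed one, and the joint event with
    [B 0 = k]. *)
Lemma prob_first_batch (K : pred nat) (o : nat -> @Xi R -> @outcome R) x D :
  (forall b, measurable_outcome (o b)) ->
  P [set w | K (B 0%N w) && good x D (o (B 0%N w) (busy_input w))] =
  \int[nuB]_b (if K b then PP [set xi | good x D (o b xi)] else 0).
Proof.
move=> mo.
pose f (xi : @Xi R) : \bar R :=
  if K (bsize xi) && good x D (o (bsize xi) (tailB xi)) then 1 else 0.
have mb : measurable_fun setT (fun xi : @Xi R => K (bsize xi) && good x D (o (bsize xi) (tailB xi))).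
  apply: measurable_and.
    by apply: (@measurableT_comp _ _ _ _ _ _ K) => //; exact: measurable_bsize.
  apply: (@measurable_natcase _ (@Xi R) _ bool (@bsize R) (fun b xi => good x D (o b (tailB xi)))).
    exact: measurable_bsize.
  move=> b; apply: (@measurableT_comp _ _ _ (@Xi R) (@Xi R) bool (fun xi : Xi => good x D (o b xi)) _ (@tailB R)).
    exact: measurable_good.
  exact: measurable_tailB.
have mf : measurable_fun setT f by exact: measurable_fun_ifT.
have f0 xi : 0 <= f xi by rewrite /f; case: ifP.
transitivity (\int[PP]_xi f xi).
  rewrite /f integral_if_set //.
  by rewrite -[X in measurable X]setTI; exact: (mb measurableT [set true]).
rewrite (integral_consB input_path_law) //; apply: eq_integral => b _.
have E xi : tailB (consB b xi) = xi by case: xi => [[? ?] ?].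
rewrite /f; under eq_integral => xi _ do rewrite E {1 2}/bsize /=.
case: (K b) => /=; last by rewrite integral0.
by apply: integral_if_set; exact: measurable_good_set.
Qed.

Let mbatch m b := measurable_batch1 b (@measurable_serve R m).

Lemma prob_avgBatch m x D :
  P [set w | good x D (batch (serve m) (B 0%N w) (busy_input w))] = avgBatch PP nuB (serve m) x D.
Proof.
exact: (@prob_first_batch xpredT (fun b => batch (serve m) b) x D (mbatch m)).
Qed.

Lemma prob_prBatch m k x D :
  P [set w | good x D (batch (serve m) k (busy_input w))] = prBatch PP (serve m) k x D.
Proof.
have := @prob_first_batch xpredT (fun=> batch (serve m) k) x D (fun=> mbatch m k).
move=> ->; rewrite integral_cst // -[RHS]mule1; congr (_ * _).
exact: probability_setT.
Qed.

Lemma prob_joint m k x D :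
  P [set w | (B 0%N w == k) && good x D (batch (serve m) k (busy_input w))] =
  P (B 0%N @^-1` [set k]) * prBatch PP (serve m) k x D.
Proof.
have := @prob_first_batch (fun b => b == k) (fun=> batch (serve m) k) x D (fun=> mbatch m k).
move=> ->; set c := prBatch _ _ _ _ _.
transitivity (\int[nuB]_b ((if b == k then 1 else 0) * c)).
  by apply: eq_integral => b _; case: eqP => _; rewrite ?mul1e ?mul0e.
rewrite ge0_integralZr //; last 2 first.
- by move=> b _; case: ifP.
- exact: prBatch_ge0.
rewrite integral_if_set //; congr (_ * _).
transitivity (P (B 0%N @^-1` [set t | t == k])); first by [].
congr (P _); by apply/seteqP; split=> w /= /eqP.
Qed.

Let M w := busy_max (A ^~ w) (B ^~ w) (S ^~ w) (B 0%N w).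
Let N w := serv0_arrivals (A ^~ w) (B ^~ w) (S ^~ w) (B 0%N w).
Let Mk k w := busy_max (A ^~ w) (B ^~ w) (S ^~ w) k.

Lemma measurable_M : measurable_fun setT M.
Proof. exact: measurable_busy_max. Qed.

Lemma measurable_N : measurable_fun setT N.
Proof. exact: measurable_serv0_arrivals. Qed.

Lemma measurable_Mk k : measurable_fun setT (Mk k).
Proof. by apply: measurable_busy_max. Qed.

Lemma measurable_le_set (f : Omega -> \bar R) x : measurable_fun setT f ->
  measurable [set w | f w <= x].
Proof.
by move=> mf; rewrite -[X in measurable X]setTI; exact: emeasurable_fun_infty_c.
Qed.

Let avgBatch_cvg := avgBatch_cvg1 input_path_law service_nonneg lam0 gap_tail law_stable.
Let prBatch_cvg := prBatch_cvg1 input_path_law service_nonneg lam0 gap_tail law_stable.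

Lemma measurable_busy_input : measurable_fun setT busy_input.
Proof. by apply: measurable_tailB; exact: measurable_input_path. Qed.

Lemma measurable_good_first_batch m x D :
  measurable [set w | good x D (batch (serve m) (B 0%N w) (busy_input w))].
Proof.
apply: measurable_good_set.
exact: (measurable_batch_nat (@measurable_serve R m) (mB 0) measurable_busy_input).
Qed.

Lemma measurable_good_batch m k x D :
  measurable [set w | good x D (batch (serve m) k (busy_input w))].
Proof.
by apply: measurable_good_set; apply: measurable_batch;
  [exact: measurable_serve|exact: measurable_busy_input].
Qed.

(** On completed busy periods the recursion computes [M], and completion has probability tending to
    1. *)
Lemma max_law_cvg x :
  avgBatch PP nuB (serve m) x xpredT @[m --> \oo] --> P [set w | M w <= x].
Proof.
have c : P [set w | good +oo xpredT (batch (serve m) (B 0%N w) (busy_input w))] @[m --> \oo] --> 1.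
  by under eq_fun do rewrite prob_avgBatch; exact: avgBatch_cvg.
have := cvg_prob_setI (measurable_le_set x measurable_M)
  (fun m => measurable_good_first_batch m +oo xpredT) c.
under eq_fun => m.
  rewrite (_ : _ `&` _ = [set w | good x xpredT (batch (serve m) (B 0%N w) (busy_input w))]).
    rewrite prob_avgBatch; over.
  apply/seteqP; split=> w /=; rewrite /good.
    by move=> [Mx /andP[okw _]]; rewrite okw andbT /=; case: (busy_sound okw) => <- _.
  move=> /and3P[okw hx _]; rewrite okw leey; split => //.
  by rewrite /M; case: (busy_sound okw) => -> _.
by [].
Qed.

Lemma max_law_cvg_k k x :
  prBatch PP (serve m) k x xpredT @[m --> \oo] --> P [set w | Mk k w <= x].
Proof.
have c : P [set w | good +oo xpredT (batch (serve m) k (busy_input w))] @[m --> \oo] --> 1.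
  by under eq_fun do rewrite prob_prBatch; exact: prBatch_cvg.
have := cvg_prob_setI (measurable_le_set x (measurable_Mk k))
  (fun m => measurable_good_batch m k +oo xpredT) c.
under eq_fun => m.
  rewrite (_ : _ `&` _ = [set w | good x xpredT (batch (serve m) k (busy_input w))]).
    rewrite prob_prBatch; over.
  apply/seteqP; split=> w /=; rewrite /good.
    by move=> [Mx /andP[okw _]]; rewrite okw andbT /=; case: (busy_sound okw) => <- _.
  move=> /and3P[okw hx _]; rewrite okw leey; split => //.
  by rewrite /Mk; case: (busy_sound okw) => -> _.
by [].
Qed.

Let E k n := [set w | B 0%N w = k /\ N w = (n%:R)%:E].

Lemma measurable_conditioning k n : measurable (E k n).
Proof.
rewrite (_ : E k n = B 0%N @^-1` [set k] `&` N @^-1` [set n%:R%:E]) //.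
apply: measurableI; first exact: mB1.
by rewrite -[X in measurable X]setTI; exact: measurable_N.
Qed.

Lemma joint_law_cvg k n x : (0 < k)%N ->
  P (B 0%N @^-1` [set k]) * prBatch PP (serve m) k x (fun j => j == n) @[m --> \oo] -->
  P ([set w | M w <= x] `&` E k n).
Proof.
move=> k0.
have c : P [set w | good +oo xpredT (batch (serve m) (B 0%N w) (busy_input w))] @[m --> \oo] --> 1.
  by under eq_fun do rewrite prob_avgBatch; exact: avgBatch_cvg.
have mG := measurableI _ _ (measurable_le_set x measurable_M) (measurable_conditioning k n).
have := cvg_prob_setI mG (fun m => measurable_good_first_batch m +oo xpredT) c.
under eq_fun => m.
  rewrite (_ : _ `&` _ = [set w | (B 0%N w == k) &&
    good x (fun j => j == n) (batch (serve m) k (busy_input w))]).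
    rewrite prob_joint; over.
  apply/seteqP; split=> w /=; rewrite /good.
    move=> [[Mx [Bk Nn]] /andP[okw _]]; move: Mx Nn okw.
    rewrite /M /N Bk eqxx => Mx Nn okw; have [<- h] := busy_sound okw.
    by rewrite okw Mx /=; move: Nn; rewrite h // => -[] /eqP; rewrite eqr_nat.
  move=> /and4P[/eqP Bk okw hx /eqP Nn].
  rewrite /M /E /= /N Bk leey okw; have [-> h] := busy_sound okw.
  by rewrite h // Nn.
by [].
Qed.

(** Both sides are limits of the same truncated probability: the left one along sample paths, the
    right one through the factorization [prBatch_count]. *)
Lemma joint_law k n x :
  P ([set w | M w <= x] `&` E k.+1 n) = P (B 0%N @^-1` [set k.+1]) *
  ((if 1 <= x - k%:R%:E then P [set w | M w <= x - k%:R%:E - 1] ^+ n else 0) *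
   avgCount nuA nuS n * P [set w | Mk k w <= x]).
Proof.
have mP V : measurable V -> P V \is a fin_num by move=> mV; exact: fin_num_measure.
have mM y := mP _ (measurable_le_set y measurable_M).
have mMk j y := mP _ (measurable_le_set y (measurable_Mk j)).
have Wfin := avgCount_fin nuA nuS n.
have cfin : (if 1 <= x - k%:R%:E then P [set w | M w <= x - k%:R%:E - 1] ^+ n else 0) \is a fin_num.
  by case: ifP => // _; rewrite fin_numX.
have c1 := @joint_law_cvg k.+1 n x isT.
have c2 : P (B 0%N @^-1` [set k.+1]) * prBatch PP (serve m) k.+1 x (fun j => j == n) @[m --> \oo] -->
  P (B 0%N @^-1` [set k.+1]) *
  ((if 1 <= x - k%:R%:E then P [set w | M w <= x - k%:R%:E - 1] ^+ n else 0) *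
   avgCount nuA nuS n * P [set w | Mk k w <= x]).
  apply: cvgeZl; first exact: mP.
  under eq_fun do rewrite (prBatch_count input_path_law (exp_law_neg gap_tail) service_nonneg
    (exp_law_memoryless gap_tail)).
  apply: cvgeM; [|apply: cvgeM|exact: max_law_cvg_k].
  - by apply: mule_def_fin => //; rewrite fin_numM.
  - exact: mule_def_fin.
  - by apply: countCoef_cvg => //; exact: max_law_cvg.
  - exact: cvg_cst.
exact: (cvg_unique _ c1 c2).
Qed.

(** At [x = +oo], [joint_law] gives the probability of [E k.+1 n] as that of [B 0 = k.+1] times
    [avgCount]; substituting it back eliminates the law of the number of arrivals. *)
Lemma joint_law_factor k n (x : R) :
  P ([set w | M w <= x%:E] `&` E k.+1 n) = P (E k.+1 n) *
  ((if (k.+1%:R <= x)%R then P [set w | M w <= (x - k.+1%:R)%:E] ^+ n else 0) *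
   P [set w | Mk k w <= x%:E]).
Proof.
have top (f : Omega -> \bar R) : P [set w | f w <= +oo] = 1.
  rewrite (_ : [set w | _] = setT) ?probability_setT //.
  by apply/seteqP; split=> w //= _; rewrite leey.
have expe1n j : (1 : \bar R) ^+ j = 1 by elim: j => // j IH; rewrite expeS IH mule1.
have := joint_law k n +oo; rewrite !addye // leey !top expe1n mul1e mule1.
rewrite (_ : _ `&` E k.+1 n = E k.+1 n); last first.
  by apply/seteqP; split=> [w []|w Ew] //; split => //=; rewrite leey.
move=> ->; rewrite joint_law -!muleA; congr (_ * _).
rewrite muleCA !muleA; congr (_ * _ * _).
have -> : (1 <= x%:E - k%:R%:E) = (k.+1%:R <= x)%R.
  by rewrite -EFinB lee_fin lerBrDr nat1r.
have -> // : x%:E - k%:R%:E - 1 = (x - k.+1%:R)%:E.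
by rewrite -!EFinB -addrA -opprD natr1.
Qed.

End BusyPeriod.

(** * Maxima of independent variables and the conclusion *)

Section MaxOfIndependent.
Set Implicit Arguments.
Unset Strict Implicit.
Context {R : realType} {d : measure_display} {T : measurableType d}.
Local Open Scope ereal_scope.

Lemma measurable_bigmaxe (I : Type) (s : seq I) (Y : I -> T -> \bar R) :
  (forall i, measurable_fun setT (Y i)) ->
  measurable_fun setT (fun w => \big[Order.max/0]_(i <- s) Y i w).
Proof.
move=> mY; elim: s => [|i s IH].
  by under eq_fun do rewrite big_nil; exact: measurable_cst.
by under eq_fun do rewrite big_cons; exact: measurable_maxe.
Qed.

(** The condition on [k] comes from the value 0 from which the maximum starts; it matches the test
    in [joint_law_factor], also for [n = 0]. *)
Lemma max_shift_le (n k : nat) (y : 'I_n -> \bar R) (z : \bar R) (x : R) :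
  Order.max (\big[Order.max/0]_(i < n) y i + k%:R%:E) z <= x%:E <->
  [/\ (k%:R <= x)%R, z <= x%:E & forall i, y i <= (x - k%:R)%:E].
Proof.
rewrite ge_max -leeBrDr // -EFinB; split.
  move=> /andP[/bigmax_leP[h0 h] zx]; split => //; last by move=> i; exact: h.
  by rewrite -subr_ge0 -lee_fin.
move=> [kx zx h]; rewrite zx andbT; apply/bigmax_leP; split => //.
by rewrite lee_fin subr_ge0.
Qed.

End MaxOfIndependent.

Theorem theorem1 (R : realType) (d : measure_display) (Omega : measurableType d)
  (P : probability Omega R) (lam : R)
  (A : nat -> Omega -> R) (B : nat -> Omega -> nat) (S : nat -> Omega -> R) :
  (* Poisson batch arrivals of rate lam: i.i.d. Exp(lam) interarrival times *)
  0 < lam ->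
  (forall i, measurable_fun setT (A i)) ->
  (forall i (V : set R), measurable V ->
     P (A i @^-1` V) = exponential_prob lam V) ->
  (* i.i.d. batch sizes distributed as X (X >= 1) *)
  (forall i j, measurable (B i @^-1` [set j])) ->
  (forall i j, P (B i @^-1` [set j]) = P (B 0%N @^-1` [set j])) ->
  P [set w | (1 <= B 0%N w)%N] = 1%E ->
  (* i.i.d. (nonnegative) service times distributed as S *)
  (forall i, measurable_fun setT (S i)) ->
  (forall i (V : set R), measurable V ->
     P (S i @^-1` V) = P (S 0%N @^-1` V)) ->
  P [set w | 0 <= S 0%N w] = 1%E ->
  (* all independent *)
  inputs_independent P A B S ->
  (* stability: lam * E[X] * E[S] < 1 *)
  (lam%:E * (\int[P]_w ((B 0%N w)%:R)%:E) * (\int[P]_w (S 0%N w)%:E) < 1)%E ->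
  let X0 := fun w => B 0%N w in
  let M := fun w => busy_max (fun j => A j w) (fun j => B j w) (fun c => S c w) (X0 w) in
  let N := fun w => serv0_arrivals (fun j => A j w) (fun j => B j w) (fun c => S c w) (X0 w) in
  (* M(k) : law of the maximum in a busy period started by a batch of size k *)
  let Mk := fun (k : nat) w => busy_max (fun j => A j w) (fun j => B j w) (fun c => S c w) k in
  forall (k n : nat), (1 <= k)%N ->
    P [set w | X0 w = k /\ N w = (n%:R)%:E] != 0%E ->
    forall (d' : measure_display) (Omega' : measurableType d') (Q : probability Omega' R)
      (Y : 'I_n -> Omega' -> \bar R) (Z : Omega' -> \bar R),
      (forall i, measurable_fun setT (Y i)) -> measurable_fun setT Z ->
      (* Y i are copies of M, Z is distributed as M(k-1) *)
      (forall i (V : set (\bar R)), measurable V -> Q (Y i @^-1` V) = P (M @^-1` V)) ->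
      (forall (V : set (\bar R)), measurable V -> Q (Z @^-1` V) = P (Mk k.-1 @^-1` V)) ->
      family_independent Q Y Z ->
      (* M(k,n) =_d max { max_i M_i + k ; M(k-1) } *)
      forall (V : set (\bar R)), measurable V ->
        (Q ((fun w' => Order.max (\big[Order.max/0%E]_(i < n) Y i w' + (k%:R)%:E)%E (Z w'))
               @^-1` V))
        = (cond_prob P M [set w | X0 w = k /\ N w = (n%:R)%:E] V)%:E.
Proof.
move=> lam0 mA lawA mB lawB _ mS lawS S0 indep stable X0 M N Mk [//|k] n _.
set E := [set w | _].
move=> PE0 d' Omega' Q Y Z mY mZ YM ZM indYZ.
set W := fun w' => _.
have mM : measurable_fun setT M by exact: (measurable_M mA mB mS).
have mE : measurable E by exact: (measurable_conditioning mA mB mS).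
have mW : measurable_fun setT W.
  by apply: measurable_maxe => //; apply: emeasurable_funD => //; exact: measurable_bigmaxe.
have PEfin : P E \is a fin_num by exact: fin_num_measure.
have pE0 : 0 < fine (P E) by rewrite fine_gt0 // lt0e PE0 measure_ge0 -ge0_fin_numE.
have mle (x : R) : measurable ([set y | (y <= x%:E)%E] : set (\bar R)).
  rewrite (_ : [set _ | _] = `]-oo, x%:E]%classic); first exact: emeasurable_itv.
  by apply/seteqP; split=> y /=; rewrite in_itv.
have c0 : 0 <= (fine (P E))^-1 by rewrite invr_ge0 ltW.
(* The conditional law is written as a measure, [P] restricted to [E], pushed forward by [M] and
   rescaled, so that [ereal_measure_ext] applies. *)
have condE V : measurable V -> ((cond_prob P M E V)%:E =
    mscale (NngNum c0) (pushforward (mrestr P mE) M) V)%E.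
  move=> mV; rewrite /cond_prob /mscale /pushforward /mrestr /= mulrC EFinM fineK //.
  apply: fin_num_measure; apply: measurableI => //.
  by rewrite -[X in measurable X]setTI; exact: mM.
move=> V mV; rewrite condE // -[LHS]/(pushforward Q W V).
apply: (@ereal_measure_ext _ (pushforward Q W)
  (mscale (NngNum c0) (pushforward (mrestr P mE) M))) => //.
- exact: (probability_setT Q).
- transitivity ((fine (P E))^-1%:E * P (setT `&` E))%E; first by [].
  by rewrite setTI -[X in (_ * X)%E]fineK // -EFinM mulVf // gt_eqF.
move=> x; transitivity (Q [set w' | (W w' <= x%:E)%E]); first by [].
transitivity ((fine (P E))^-1%:E * P ([set w | (M w <= x%:E)%E] `&` E))%E; last by [].
rewrite (joint_law_factor lam0 mA lawA mB lawB mS lawS S0 indep stable k n x).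
rewrite -/E muleA -{2}[P E](fineK PEfin) -EFinM mulVf ?gt_eqF // mul1e.
have pM y : measurable [set w | (M w <= y)%E] by exact: measurable_le_set.
have mMk : measurable_fun setT (Mk k) by exact: (measurable_Mk mA mB mS).
have pMk y : measurable [set w | (Mk k w <= y)%E] by exact: measurable_le_set.
(* Here [k.+1] is the size of the first batch; below that level both sides vanish. *)
case: ifPn => kx; last first.
  rewrite mul0e (_ : [set w' | _] = set0) ?measure0 //; apply/seteqP; split=> // w /=.
  by move=> /max_shift_le[]; rewrite (negbTE kx).
rewrite (_ : [set w' | _] = Z @^-1` [set y | (y <= x%:E)%E] `&`
   \bigcap_(i in [set: 'I_n]) (Y i @^-1` [set y | (y <= (x - k.+1%:R)%:E)%E])); last first.
  apply/seteqP; split=> w /=.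
    by move=> /max_shift_le[_ zx yx]; split => // i _ /=; exact: yx.
  by move=> [zx yx]; apply/max_shift_le; split => // i; exact: yx.
(* All copies are tested against the same ray, so the product of their marginals is the [n]-th power
   found in [joint_law_factor]. *)
rewrite (indYZ (fun=> [set y | (y <= (x - k.+1%:R)%:E)%E])) //.
rewrite ZM //; under eq_bigr do rewrite YM //.
rewrite prodr_const card_ord EFinM fineK; last by apply: fin_num_measure; exact: (pMk x%:E).
rewrite muleC; congr (_ * _)%E.
by rewrite EFin_expe fineK //; apply: fin_num_measure; exact: pM.
Qed.
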